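(* Let $Y\in\Omega_n^r$ be a random simplicial complex with respect to $\mathbb{P}_{r,\mathfrak p}$, where $\mathfrak p=(p_0,p_1,\dots,p_r)$, $p_i=n^{-\alpha_i}$, and $\alpha=\alpha(n)=(\alpha_0,\dots,\alpha_r)\in\mathbb{R}_+^{r+1}$ is a sequence of vectors converging to a vector $\alpha_\ast\in\mathfrak{D}_k$, where $3\le k\le r$. Then $\pi_1(Y)=1$, i.e. $Y$ is simply connected, a.a.s.
   Context: Model. Fix an integer $r$. Let $\Delta_n$ be the simplex with vertex set $\{1,\dots,n\}$, viewed as an abstract simplicial complex. For a subcomplex $Y\subset\Delta_n$, $f_i(Y)$ is the number of $i$-dimensional simplexes of $Y$, and $e_i(Y)$ is the number of $i$-dimensional external faces of $Y$, i.e. $i$-simplexes $\sigma\subset\Delta_n$ with $\sigma\not\subset Y$ but $\partial\sigma\subset Y$ (for $i=0$: vertices not in $Y$). $\Omega_n^r$ is the set of all subcomplexes $Y\subset\Delta_n$ with $\dim Y\le r$ (including the empty one). For $\mathfrak p=(p_0,\dots,p_r)$ with $0\le p_i\le 1$ the probability measure on $\Omega_n^r$ is $$\mathbb{P}_{r,\mathfrak p}(Y)=\prod_{i=0}^r p_i^{f_i(Y)}\cdot\prod_{i=0}^r(1-p_i)^{e_i(Y)},\qquad 0^0=1.$$ Notation. $\mathbb{R}_+=[0,\infty)$. For $\alpha=(\alpha_0,\dots,\alpha_r)$ and $k=0,\dots,r$ put $\psi_k(\alpha)=\sum_{i=0}^r\binom{k}{i}\alpha_i$, with $\binom{k}{i}=0$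 for $i>k$ and $\binom00=1$. Domains: $\mathfrak{D}_k=\{\alpha\in\mathbb{R}^{r+1}_+:\psi_k(\alpha)<1<\psi_{k+1}(\alpha)\}$ for $0\le k\le r-1$, and $\mathfrak{D}_r=\{\alpha\in\mathbb{R}^{r+1}_+:\psi_r(\alpha)<1\}$. ''A.a.s.'' means with probability tending to $1$ as $n\to\infty$. *)

(* Defs.v *)
From HB Require Import structures.
From mathcomp Require Import all_boot all_order all_algebra.
From mathcomp Require Import all_classical all_reals all_analysis.
Set Implicit Arguments.
Unset Strict Implicit.
Unset Printing Implicit Defensive.
Import Order.TTheory GRing.Theory Num.Theory.
Import numFieldNormedType.Exports.
Local Open Scope classical_set_scope.
Local Open Scope ring_scope.

Section Complexes.
Variable n : nat.
Implicit Types (Y : {set {set 'I_n}}) (s t : {set 'I_n}).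

(* A subcomplex of the simplex Delta_n is the set of its simplexes, which are
   nonempty vertex sets: an i-dimensional simplex has i + 1 elements, and set0
   is never a member.  Y = set0 is the empty complex. *)
Definition subcomplex Y : bool :=
  (finset.set0 \notin Y) &&
  [forall s in Y, forall t : {set 'I_n},
     (t != finset.set0) && (t \subset s) ==> (t \in Y)].

Definition Omega (r : nat) : {set {set {set 'I_n}}} :=
  [set Y | subcomplex Y && [forall s in Y, #|s| <= r.+1]%N]%SET.

Definition faces (i : nat) Y : nat := #|[set s in Y | #|s| == i.+1]%SET|.

(* For i = 0 the boundary condition is vacuous: external vertices are the
   vertices that are not in Y. *)
Definition external_face Y s : bool :=
  (s \notin Y) &&
  [forall t : {set 'I_n}, (t != finset.set0) && (t \proper s) ==> (t \in Y)].

Definition external_faces (i : nat) Y : nat :=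
  #|[set s : {set 'I_n} | (#|s| == i.+1) && external_face Y s]%SET|.

End Complexes.

Section Probability.
Variables (R : realType) (r : nat).

(* The library has x ^+ 0 = 1 for every x, in particular 0 ^+ 0 = 1. *)
Definition Pweight (n : nat) (p : 'I_r.+1 -> R) (Y : {set {set 'I_n}}) : R :=
  (\prod_(i < r.+1) p i ^+ faces i Y) *
  (\prod_(i < r.+1) (1 - p i) ^+ external_faces i Y).

Definition Prob (n : nat) (p : 'I_r.+1 -> R)
    (E : {set {set 'I_n}} -> Prop) : R :=
  \sum_(Y in Omega n r | `[< E Y >]) Pweight p Y.

Definition psi (k : nat) (a : 'rV[R]_r.+1) : R :=
  \sum_(i < r.+1) 'C(k, i)%:R * a ord0 i.

Definition frakD (k : nat) : set 'rV[R]_r.+1 :=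
  [set a : 'rV[R]_r.+1 | [/\ forall i, 0 <= a ord0 i,
               psi k a < 1 &
               (k < r)%N -> 1 < psi k.+1 a]].

End Probability.

Section FundamentalGroup.
Variables (R : realType) (T : topologicalType) (A : set T).

Definition is_path (x y : T) (g : R -> T) : Prop :=
  [/\ {within `[0, 1], continuous g},
      forall t : R, t \in `[0, 1] -> A (g t),
      g 0 = x & g 1 = y].

(* Homotopy in A relative to the endpoints; H (s, t) is the position at time t
   on the s-th intermediate path. *)
Definition path_homotopic (x y : T) (f g : R -> T) : Prop :=
  exists H : R * R -> T,
    [/\ {within `[0, 1] `*` `[0, 1], continuous H},
        forall t : R, t \in `[0, 1] -> H (0, t) = f t /\ H (1, t) = g t &
        forall s : R, s \in `[0, 1] -> is_path x y (fun t => H (s, t))].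

(* Every element of pi_1(A, x) is the class of the constant loop. *)
Definition pi1_trivial (x : T) : Prop :=
  forall g, is_path x x g -> path_homotopic x x g (cst x).

Definition path_connected : Prop :=
  forall x y, A x -> A y -> exists g, is_path x y g.

Definition simply_connected : Prop :=
  [/\ A !=set0, path_connected & forall x, A x -> pi1_trivial x].

End FundamentalGroup.

Arguments is_path R {T} A x y g.
Arguments path_homotopic R {T} A x y f g.
Arguments pi1_trivial R {T} A x.
Arguments path_connected R {T} A.
Arguments simply_connected R {T} A.

(* Barycentric coordinates: points of the standard simplex in R^n whose
   support is a simplex of Y, with the topology induced by R^n. *)
Definition realization (R : realType) (n : nat) (Y : {set {set 'I_n}}) :
    set 'rV[R]_n :=
  [set x : 'rV[R]_n | [/\ forall i, 0 <= x ord0 i,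
               \sum_(i < n) x ord0 i = 1 &
               [set i | x ord0 i != 0]%SET \in Y]].

Arguments realization R {n} Y.

(* Main.v *)
Require Import Defs.
From HB Require Import structures.
From mathcomp Require Import all_boot all_order all_algebra.
From mathcomp Require Import all_classical all_reals all_analysis.
From mathcomp Require Import ring lra zify.
Set Implicit Arguments.
Unset Strict Implicit.
Unset Printing Implicit Defensive.
Import Order.TTheory GRing.Theory Num.Theory.
Import numFieldNormedType.Exports.
Local Open Scope classical_set_scope.
Local Open Scope ring_scope.

(** Why the theorem is true.  The binomial coefficients in [psi] grow with [k], so
    for [3 <= k] the hypothesis [psi k a < 1] on the limit exponents gives
    [a_0 + 3 a_1 + 3 a_2 < 1]; this inequality makes the complex simply
    connected.

    Probability.  Keep every nonempty vertex set [s], independently, with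
    probability [p_i], where [i] is the dimension of [s]; the largest complex of
    dimension at most [r] all of whose faces are kept has exactly the law
    [Pweight] ([Prob_pr]), because it equals [Y] if and only if all faces of [Y]
    are kept and no external face is.  So all estimates are about independent
    coins.  With [c = p_0 p_1^3 p_2^3], the mean number of vertices [z] that cone
    off the boundary of a given triangle is about [n c], a positive power of
    [n].  Three events then fail with superpolynomially small probability:
    every 3-set of vertices has such a cone point ([pr_cones]); in the common
    neighbourhood of two vertices, every small set has a further neighbour
    ([pr_expands]); any two disjoint large vertex sets are joined by an edge
    ([pr_joined]).  The threshold [m] between small and large is slightly above
    [1 / p_1].  [good_bound] collects the estimates.

    Combinatorics.  Expansion and joining make every common neighbourhood
    connected: a small component would grow, and two large ones would be joined
    ([common_connected]).  The cone points make every triangle of edges bound a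
    disc ([edge_triangle]), and connectedness lets one sweep a 4-cycle
    [u v w v'] from [v] to [v'] through common neighbours of [u] and [w], two
    triangles at a time ([edge_square]).

    Topology.  Fix a vertex [b].  To each vertex [v] attach the class of the
    paths [b - c - v], [c] a common neighbour; squares make it independent of
    [c], and triangles make it compatible with edges ([radial_edge]).  Adding a
    final segment inside a simplex attaches a class to every point, and
    composing with a path from [x] to [y] carries the class of [x] to the class
    of [y]: this is local in the path, and a Lebesgue number for the cover by
    open stars reduces it to paths inside one star ([radial_to_pcat]).  Hence a
    loop at [x] fixes the class of [x], and cancelling that class shows that
    the loop is null-homotopic ([npath_pi1]). *)

(** * Continuity of explicit expressions *)

Section Continuity.
Context {R : realType}.

(** Everywhere-continuity under a head constant: the tactic below matches on it
    syntactically and never unfolds the topologies. *)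
Definition cts (S T : topologicalType) (f : S -> T) : Prop := continuous f.

Lemma cont_pair (S T U : topologicalType) (f : S -> T) (g : S -> U) :
  cts f -> cts g -> cts (fun s => (f s, g s)).
Proof. by move=> cf cg s; exact: (cvg_pair (cf s) (cg s)). Qed.

Lemma cont_comp (S T U : topologicalType) (f : T -> U) (g : S -> T) :
  cts f -> cts g -> cts (fun s => f (g s)).
Proof. by move=> cf cg s; apply: continuous_comp; [exact: cg|exact: cf]. Qed.

Lemma cont_fst (T U : topologicalType) : cts (fun p : T * U => p.1).
Proof. by move=> p; exact: cvg_fst. Qed.

Lemma cont_snd (T U : topologicalType) : cts (fun p : T * U => p.2).
Proof. by move=> p; exact: cvg_snd. Qed.

Lemma cont_cst (S T : topologicalType) (c : T) : cts (fun _ : S => c).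
Proof. by move=> s; exact: cvg_cst. Qed.

Lemma cont_id (S : topologicalType) : cts (fun s : S => s).
Proof. by move=> s; exact: cvg_id. Qed.

Lemma contD (S : topologicalType) (V : normedModType R) (f g : S -> V) :
  cts f -> cts g -> cts (fun s => f s + g s).
Proof. by move=> cf cg s; apply: cvgD; [exact: cf|exact: cg]. Qed.

Lemma contN (S : topologicalType) (V : normedModType R) (f : S -> V) :
  cts f -> cts (fun s => - f s).
Proof. by move=> cf s; apply: cvgN; exact: cf. Qed.

Lemma contZ (S : topologicalType) (V : normedModType R) (k : S -> R)
    (f : S -> V) :
  cts k -> cts f -> cts (fun s => k s *: f s).
Proof. by move=> ck cf s; apply: cvgZ; [exact: ck|exact: cf]. Qed.

Lemma contM (S : topologicalType) (f g : S -> R) :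
  cts f -> cts g -> cts (fun s => f s * g s).
Proof. by move=> cf cg s; apply: cvgM; [exact: cf|exact: cg]. Qed.

Lemma cont_norm (S : topologicalType) (f : S -> R) :
  cts f -> cts (fun s => `|f s|).
Proof. by move=> cf; apply: (cont_comp (@norm_continuous _ _) cf). Qed.

(** Precomposition with the retraction of the line onto [0, 1] turns functions on
    the unit interval into globally continuous ones. *)
Definition clamp (t : R) : R := Order.max 0 (Order.min t 1).

Lemma cont_clamp (S : topologicalType) (f : S -> R) :
  cts f -> cts (fun s => clamp (f s)).
Proof.
move=> cf s; apply: (@continuous_max R S (fun=> 0) (fun s => Order.min (f s) 1)).
  exact: cvg_cst.
by apply: (@continuous_min R S f (fun=> 1)); [exact: cf|exact: cvg_cst].
Qed.

Lemma clamp_le0 t : t <= 0 -> clamp t = 0.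
Proof. by move=> t0; apply/max_idPl; rewrite ge_min t0. Qed.

Lemma clamp_ge1 t : 1 <= t -> clamp t = 1.
Proof. by move=> t1; rewrite /clamp (min_idPr t1) (max_idPr ler01). Qed.

Lemma clamp_id t : 0 <= t <= 1 -> clamp t = t.
Proof. by case/andP=> t0 t1; rewrite /clamp (min_idPl t1) (max_idPr t0). Qed.

Lemma clamp_itv t : 0 <= clamp t <= 1.
Proof. by rewrite le_max ge_max ge_min lexx ler01 lexx orbT. Qed.

Lemma clamp_lipschitz s t : `|clamp s - clamp t| <= `|s - t|.
Proof.
have cE u : (u <= 0 /\ clamp u = 0) \/ (1 <= u /\ clamp u = 1) \/
    (0 <= u <= 1 /\ clamp u = u).
  have [u0|u0] := leP u 0; first by left; rewrite clamp_le0.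
  have [u1|u1] := leP 1 u; first by right; left; rewrite clamp_ge1.
  by right; right; rewrite clamp_id ?(ltW u0) ?(ltW u1).
rewrite ler_norml; have := ler_norm (s - t); have := ler_norm (t - s).
rewrite distrC.
by case: (cE s) => [[? ->]|[[? ->]|[? ->]]];
  case: (cE t) => [[? ->]|[[? ->]|[? ->]]]; lra.
Qed.

End Continuity.

Ltac cont := repeat match goal with
  | |- cts (fun s => s) => exact: cont_id
  | |- cts (@fst _ _) => exact: cont_fst
  | |- cts (@snd _ _) => exact: cont_snd
  | |- cts (fun s => fst s) => exact: cont_fst
  | |- cts (fun s => snd s) => exact: cont_snd
  | cg : cts ?g |- cts ?g => exact: cg
  | |- cts (fun s => (_, _)) => apply: cont_pair
  | |- cts (fun s => clamp _) => apply: cont_clamp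
  | |- cts (fun s => `|_|) => apply: cont_norm
  | |- cts (fun s => _ + _) => apply: contD
  | |- cts (fun s => - _) => apply: contN
  | |- cts (fun s => _ *: _) => apply: contZ
  | |- cts (fun s => _ * _) => apply: contM
  | cg : cts ?g |- cts (fun s => ?g _) => apply: (cont_comp cg)
  | |- cts (fun s => ?c) => exact: cont_cst
  | |- @cts ?S ?T ?f => lazymatch f with (fun _ => _) => fail
      | _ => change (@cts S T (fun s => f s)) end
  end.

(** * Paths parametrized by the whole line *)

Section Paths.
Context {R : realType} {V : normedModType R} (A : set V).
Implicit Types (f g h : R -> V) (x y z : V).

(** Paths are constant outside [0, 1], so that they can be glued by adding and
    subtracting in the ambient vector space, which preserves continuity at once;
    a piecewise definition would call for a pasting argument each time. *)
Definition npath x y f := [/\ cts f, forall t, A (f t),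
  forall t, t <= 0 -> f t = x & forall t, 1 <= t -> f t = y].

(** Homotopies are likewise constant in the deformation parameter outside
    [0, 1]. *)
Definition nhom x y f g := exists H : R * R -> V, [/\ cts H,
  forall s, npath x y (fun t => H (s, t)),
  forall s t, s <= 0 -> H (s, t) = f t &
  forall s t, 1 <= s -> H (s, t) = g t].

Lemma nhom_npathl x y f g : nhom x y f g -> npath x y f.
Proof.
case=> H [_ /(_ 0) h H0 _].
by rewrite (_ : f = fun t => H (0, t))//; apply/funext => t; rewrite H0.
Qed.

Lemma nhom_sym x y f g : nhom x y f g -> nhom x y g f.
Proof.
case=> H [cH Hp H0 H1]; exists (fun p => H (1 - p.1, p.2)); split => /=.
- by cont.
- by move=> s; exact: Hp.
- by move=> s t s0; apply: H1; lra.
- by move=> s t s0; apply: H0; lra.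
Qed.

(** At each time one of the two homotopies is stationary at the middle path, so
    their sum minus that path is the other one. *)
Lemma nhom_trans x z f g h : nhom x z f g -> nhom x z g h -> nhom x z f h.
Proof.
case=> H [cH Hp H0 H1] [K [cK Kp K0 K1]].
have [cg _ _ _] : npath x z g by apply: (@nhom_npathl _ _ _ h); exists K.
exists (fun p => H (2 * p.1, p.2) + K (2 * p.1 - 1, p.2) - g p.2).
have e s : (fun t => H (2 * s, t) + K (2 * s - 1, t) - g t) =
    if 2 * s <= 1 then fun t => H (2 * s, t) else fun t => K (2 * s - 1, t).
  apply/funext => t; case: ifPn => [s1|/negP s1].
    by rewrite K0 ?addrK//; lra.
  by rewrite H1; [rewrite addrAC subrr add0r|lra].
split => /=.
- by cont.
- by move=> s; rewrite e; case: ifP => _; [exact: Hp|exact: Kp].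
- by move=> s t s0; rewrite H0 ?K0 ?addrK//; lra.
- by move=> s t s0; rewrite H1 ?K1; [rewrite addrAC subrr add0r|lra|lra].
Qed.

Lemma nhom_refl x y f : npath x y f -> nhom x y f f.
Proof.
case=> cf Af f0 f1; exists (fun p => f p.2); split => //; cont.
Qed.

Lemma npath_comp x y f (p : R -> R) : npath x y f -> cts p ->
  (forall t, t <= 0 -> p t <= 0) -> (forall t, 1 <= t -> 1 <= p t) ->
  npath x y (f \o p).
Proof.
move=> [cf Af f0 f1] cp p0 p1; split => //=.
- by apply: (cont_comp cf cp).
- by move=> t /p0 /f0.
- by move=> t /p1 /f1.
Qed.

(** Both half-lines are convex, so the affine homotopy from the identity to [p]
    keeps the endpoints. *)
Lemma nhom_reparam x y f (p : R -> R) : npath x y f -> cts p ->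
  (forall t, t <= 0 -> p t <= 0) -> (forall t, 1 <= t -> 1 <= p t) ->
  nhom x y f (f \o p).
Proof.
move=> fP cp p0 p1; have [cf Af f0 f1] := fP.
exists (fun q => f ((1 - clamp q.1) * q.2 + clamp q.1 * p q.2)).
split => /=.
- by cont.
- move=> s; have /andP[c0 c1] := clamp_itv s.
  apply: (npath_comp fP (p := fun t => (1 - clamp s) * t + clamp s * p t)).
  + by cont.
  + by move=> t t0; have := p0 _ t0; nra.
  + by move=> t t0; have := p1 _ t0; nra.
- by move=> s t /clamp_le0 ->; rewrite subr0 mul1r mul0r addr0.
- by move=> s t /clamp_ge1 ->; rewrite subrr mul0r mul1r add0r.
Qed.

Lemma nhom_line x y f g : npath x y f -> npath x y g ->
  (forall s t, 0 <= s <= 1 -> A ((1 - s) *: f t + s *: g t)) -> nhom x y f g.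
Proof.
move=> [cf Af f0 f1] [cg Ag g0 g1] Afg.
exists (fun q => (1 - clamp q.1) *: f q.2 + clamp q.1 *: g q.2).
split => /=.
- by cont.
- move=> s; split => /=.
  + by cont.
  + by move=> t; apply: Afg; exact: clamp_itv.
  + by move=> t t0; rewrite f0// g0// -scalerDl subrK scale1r.
  + by move=> t t0; rewrite f1// g1// -scalerDl subrK scale1r.
- by move=> s t /clamp_le0 ->; rewrite subr0 scale1r scale0r addr0.
- by move=> s t /clamp_ge1 ->; rewrite subrr scale1r scale0r add0r.
Qed.

(** Concatenation at double speed: before time 1/2 the second path sits at its
    initial point, which is [f 1], and afterwards the first one does. *)
Definition pcat f g (t : R) : V := f (2 * t) + g (2 * t - 1) - f 1.

Lemma pcatl x y z f g t : npath x y f -> npath y z g -> 2 * t <= 1 ->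
  pcat f g t = f (2 * t).
Proof. by move=> [_ _ _ f1] [_ _ g0 _] t1; rewrite /pcat (f1 1)// g0 ?addrK//; lra. Qed.

Lemma pcatr x y z f g t : npath x y f -> npath y z g -> 1 <= 2 * t ->
  pcat f g t = g (2 * t - 1).
Proof.
by move=> [_ _ _ f1] [_ _ g0 _] t1; rewrite /pcat !f1// addrAC subrr add0r.
Qed.

Lemma npath_pcat x y z f g : npath x y f -> npath y z g ->
  npath x z (pcat f g).
Proof.
move=> fP gP; have [cf Af f0 f1] := fP; have [cg Ag g0 g1] := gP; split.
- by rewrite /pcat; cont.
- move=> t; have [t1|t1] := leP (2 * t) 1.
    by rewrite (pcatl fP gP).
  by rewrite (pcatr fP gP) // ltW.
- by move=> t t0; rewrite (pcatl fP gP) ?f0//; lra.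
- by move=> t t0; rewrite (pcatr fP gP) ?g1//; lra.
Qed.

Lemma nhom_pcat x y z f f' g g' : nhom x y f f' -> nhom y z g g' ->
  nhom x z (pcat f g) (pcat f' g').
Proof.
case=> H [cH Hp H0 H1] [K [cK Kp K0 K1]].
exists (fun p => H (p.1, 2 * p.2) + K (p.1, 2 * p.2 - 1) - y); split => /=.
- by cont.
- move=> s; have := npath_pcat (Hp s) (Kp s); rewrite /pcat.
  by have [_ _ _ /(_ 1 (lexx _)) ->] := Hp s.
- move=> s t s0; rewrite H0// K0// /pcat -(H0 _ 1 s0).
  by have [_ _ _ ->] := Hp s.
- move=> s t s0; rewrite H1// K1// /pcat -(H1 _ 1 s0).
  by have [_ _ _ ->] := Hp s.
Qed.

Lemma npath_cst x : A x -> npath x x (cst x).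
Proof. by move=> Ax; split => //; cont. Qed.

Lemma nhom_idl x y f : npath x y f -> nhom x y (pcat (cst x) f) f.
Proof.
move=> fP; have [_ Af f0 f1] := fP; apply: nhom_sym.
have Ax : A x by rewrite -(f0 0).
have -> : pcat (cst x) f = f \o (fun t => 2 * t + (-1)).
  by apply/funext => t; rewrite /pcat /= addrAC subrr add0r.
apply: nhom_reparam => //; [by cont|by move=> t; lra|by move=> t; lra].
Qed.

Lemma nhom_idr x y f : npath x y f -> nhom x y (pcat f (cst y)) f.
Proof.
move=> fP; have [_ Af f0 f1] := fP; apply: nhom_sym.
have -> : pcat f (cst y) = f \o (fun t => 2 * t).
  by apply/funext => t; rewrite /pcat /= (f1 1)// addrK.
apply: nhom_reparam => //; [by cont|by move=> t; lra|by move=> t; lra].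
Qed.

Lemma nhom_assoc x y z w f g h : npath x y f -> npath y z g -> npath z w h ->
  nhom x w (pcat (pcat f g) h) (pcat f (pcat g h)).
Proof.
move=> fP gP hP; have fgP := npath_pcat fP gP; have ghP := npath_pcat gP hP.
have [_ _ f0 f1] := fP; have [_ _ g0 g1] := gP; have [_ _ h0 h1] := hP.
(* piecewise linear, sending 0, 1/4, 1/2, 1 to 0, 1/2, 3/4, 1 *)
pose q (t : R) := t + 4^-1 * clamp (4 * t) - 4^-1 * clamp (2 * t - 1).
have cq : cts q by rewrite /q; cont.
apply: nhom_sym.
have -> : pcat (pcat f g) h = pcat f (pcat g h) \o q.
  apply/funext => t /=.
  have [tn|tn] := leP t 0.
    have qt : q t = t by rewrite /q !clamp_le0; lra.
    rewrite qt (pcatl fgP hP); last lra.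
    by rewrite (pcatl fP gP) ?(pcatl fP ghP) ?f0//; lra.
  have [t4|t4] := leP (4 * t) 1.
    have qt : q t = 2 * t by rewrite /q clamp_id ?clamp_le0; lra.
    rewrite qt (pcatl fgP hP); last lra.
    by rewrite (pcatl fP gP) ?(pcatl fP ghP)//; lra.
  have [t2|t2] := leP (2 * t) 1.
    have qt : q t = t + 4^-1 by rewrite /q clamp_ge1 ?clamp_le0; lra.
    rewrite qt (pcatl fgP hP); last lra.
    rewrite (pcatr fP gP); last lra.
    rewrite (pcatr fP ghP); last lra.
    rewrite (pcatl gP hP); last lra.
    by congr g; lra.
  have [t1|t1] := leP t 1.
    have qt : q t = 2^-1 * t + 2^-1 by rewrite /q clamp_ge1 ?clamp_id; lra.
    rewrite qt (pcatr fgP hP); last lra.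
    rewrite (pcatr fP ghP); last lra.
    rewrite (pcatr gP hP); last lra.
    by congr h; lra.
  have qt : q t = t by rewrite /q !clamp_ge1; lra.
  rewrite qt (pcatr fgP hP); last lra.
  rewrite (pcatr fP ghP); last lra.
  by rewrite (pcatr gP hP) ?h1//; lra.
apply: nhom_reparam => //; first exact: npath_pcat ghP.
  by move=> t t0; rewrite /q !clamp_le0; lra.
by move=> t t0; rewrite /q !clamp_ge1; lra.
Qed.

Definition prev f (t : R) := f (1 - t).

Lemma npath_prev x y f : npath x y f -> npath y x (prev f).
Proof.
move=> [cf Af f0 f1]; split => //.
- by rewrite /prev; cont.
- by move=> t; exact: Af.
- by move=> t t0; rewrite /prev f1//; lra.
- by move=> t t0; rewrite /prev f0//; lra.
Qed.

(** The composite runs along [f] with parameter [|2 t - 1|], from 1 to 0 and back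
    to 1; pushing this parameter up to 1 contracts it. *)
Lemma nhom_prevl x y f : npath x y f -> nhom y y (pcat (prev f) f) (cst y).
Proof.
move=> fP; have rP := npath_prev fP; have [cf Af f0 f1] := fP.
have e : pcat (prev f) f = f \o (fun t => `|2 * t - 1|).
  apply/funext => t /=; have [t2|t2] := leP (2 * t) 1.
    by rewrite (pcatl rP fP)// /prev ler0_norm; [congr f; lra|lra].
  by rewrite (pcatr rP fP) ?ger0_norm//; lra.
exists (fun p => f (`|2 * p.2 - 1| + clamp p.1)); rewrite e; split => /=.
- by cont.
- move=> s; have /andP[c0 _] := clamp_itv s; split => //.
  + by cont.
  + by move=> t t0; rewrite f1// ler0_norm; lra.
  + by move=> t t0; rewrite f1// ger0_norm; lra.
- by move=> s t s0; rewrite clamp_le0// addr0.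
- by move=> s t s1; rewrite clamp_ge1// f1// lerDr.
Qed.

(** The form in which triviality of loops is obtained: a loop that fixes the class
    of some path is null-homotopic. *)
Lemma nhom_cancel x y f g : npath x y f -> npath y y g ->
  nhom x y (pcat f g) f -> nhom y y g (cst y).
Proof.
move=> fP gP h; have rP := npath_prev fP.
have rr := nhom_refl rP.
apply: nhom_trans (nhom_sym (nhom_idl gP)) _ => //.
apply: nhom_trans (nhom_pcat (nhom_sym (nhom_prevl fP)) (nhom_refl gP)) _ => //.
apply: nhom_trans (nhom_assoc rP fP gP) _ => //.
apply: nhom_trans (nhom_pcat rr h) _ => //.
exact: nhom_prevl fP.
Qed.

End Paths.

(** * The realization of a complex *)

Section Realization.
Context {R : realType} {n : nat} (Y : {set {set 'I_n}}) (hY : subcomplex Y).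
Local Notation V := 'rV[R]_n.
Local Notation A := (realization R Y).
Implicit Types (x y z : V) (s t : R) (u v w : 'I_n).

Definition supp x : {set 'I_n} := [set i | x ord0 i != 0]%SET.

Lemma subcomplexW (s t : {set 'I_n}) :
  s \in Y -> t != finset.set0 -> t \subset s -> t \in Y.
Proof.
move=> sY t0 ts; have /andP[_ /forall_inP/(_ _ sY)/forallP/(_ t)] := hY.
by rewrite t0 ts.
Qed.

Lemma realization_supp x : A x -> supp x \in Y. Proof. by case. Qed.

Lemma realization_supp0 x : A x -> exists v, v \in supp x.
Proof.
move=> /realization_supp sY; apply/set0Pn; apply: contraL hY => /eqP s0.
by rewrite /subcomplex -s0 sY.
Qed.

Lemma realization_line x y s (T : {set 'I_n}) : A x -> A y -> T \in Y ->
  supp x \subset T -> supp y \subset T -> 0 <= s <= 1 ->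
  A ((1 - s) *: x + s *: y) /\ supp ((1 - s) *: x + s *: y) \subset T.
Proof.
move=> [x0 x1 _] [y0 y1 _] TY /fintype.subsetP xT /fintype.subsetP yT /andP[s0 s1].
set z := _ + _.
have zE i : z ord0 i = (1 - s) * x ord0 i + s * y ord0 i by rewrite !mxE.
have zT : supp z \subset T.
  apply/fintype.subsetP => i; rewrite inE zE; apply: contraR => iT.
  have := contra (xT i) iT; have := contra (yT i) iT.
  by rewrite !inE !negbK => /eqP -> /eqP ->; rewrite !mulr0 addr0.
have z1 : \sum_(i < n) z ord0 i = 1.
  under eq_bigr do rewrite zE.
  by rewrite big_split /= -!mulr_sumr x1 y1; lra.
split => //; split => //.
- by move=> i; rewrite zE; have := x0 i; have := y0 i; nra.
- apply: (subcomplexW TY) zT; apply/eqP => z0.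
  move: z1; rewrite big1 => [/eqP|i _]; first by rewrite eq_sym oner_eq0.
  apply/eqP; apply: contraT => zi; have : i \in supp z by rewrite inE.
  by rewrite z0 inE.
Qed.

(** Two paths that at each time lie in a common closed simplex are joined by the
    straight-line homotopy. *)
Lemma nhom_contiguous x y (f g : R -> V) : npath A x y f -> npath A x y g ->
  (forall t, exists T, [/\ T \in Y, supp (f t) \subset T & supp (g t) \subset T]) ->
  nhom A x y f g.
Proof.
move=> fP gP H; apply: nhom_line => // s t s01.
have [T [TY fT gT]] := H t; have [_ fA _ _] := fP; have [_ gA _ _] := gP.
by case: (realization_line (fA t) (gA t) TY fT gT s01).
Qed.

Definition seg x y (t : R) : V := (1 - clamp t) *: x + clamp t *: y.

Lemma supp_seg x y t (T : {set 'I_n}) : A x -> A y -> T \in Y ->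
  supp x \subset T -> supp y \subset T -> supp (seg x y t) \subset T.
Proof.
by move=> Ax Ay TY xT yT; case: (realization_line Ax Ay TY xT yT (clamp_itv t)).
Qed.

Lemma npath_seg x y (T : {set 'I_n}) : A x -> A y -> T \in Y ->
  supp x \subset T -> supp y \subset T -> npath A x y (seg x y).
Proof.
move=> Ax Ay TY xT yT; split.
- by rewrite /seg; cont.
- by move=> t; case: (realization_line Ax Ay TY xT yT (clamp_itv t)).
- by move=> t /clamp_le0 t0; rewrite /seg t0 subr0 scale1r scale0r addr0.
- by move=> t /clamp_ge1 t0; rewrite /seg t0 subrr scale1r scale0r add0r.
Qed.

Lemma supp_pcat x y z (f g : R -> V) t (T : {set 'I_n}) :
  npath A x y f -> npath A y z g ->
  (forall t, supp (f t) \subset T) -> (forall t, supp (g t) \subset T) ->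
  supp (pcat f g t) \subset T.
Proof.
move=> fP gP fT gT; have [t1|t1] := leP (2 * t) 1.
  by rewrite (pcatl fP gP).
by rewrite (pcatr fP gP) // ltW.
Qed.

Lemma seg_triangle x y z (T : {set 'I_n}) : A x -> A y -> A z -> T \in Y ->
  supp x \subset T -> supp y \subset T -> supp z \subset T ->
  nhom A x z (pcat (seg x y) (seg y z)) (seg x z).
Proof.
move=> Ax Ay Az TY xT yT zT.
have xyP := npath_seg Ax Ay TY xT yT; have yzP := npath_seg Ay Az TY yT zT.
apply: nhom_contiguous.
- exact: npath_pcat xyP yzP.
- exact: npath_seg TY xT zT.
move=> t; exists T; split => //; last exact: supp_seg.
by apply: supp_pcat xyP yzP _ _ => s; exact: supp_seg.
Qed.

Definition vert v : V := delta_mx ord0 v.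

Lemma supp_vert v : supp (vert v) = [set v]%SET.
Proof.
by apply/setP => i; rewrite !inE mxE eqxx /= pnatr_eq0 eqb0 negbK.
Qed.

Lemma vert_in v : [set v]%SET \in Y -> A (vert v).
Proof.
move=> vY; split; last by rewrite -[[set _ | _]%SET]/(supp (vert v)) supp_vert.
- by move=> i; rewrite mxE; case: (_ && _).
- rewrite (bigD1 v)//= mxE !eqxx big1 ?addr0// => i iv.
  by rewrite mxE (negbTE iv) andbF.
Qed.

Lemma supp_vertP x v : A x -> v \in supp x ->
  [/\ A (vert v), supp (vert v) \subset supp x & [set v]%SET \in Y].
Proof.
move=> Ax vx; have xY := realization_supp Ax.
have vY : [set v]%SET \in Y.
  apply: (subcomplexW xY); last by rewrite finset.sub1set.
  by apply/set0Pn; exists v; rewrite inE.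
by split => //; [exact: vert_in|rewrite supp_vert finset.sub1set].
Qed.

(** The open star of [v] contracts to [v] along segments.  To keep the endpoints
    fixed, [g] is first slowed down to rest at both ends, so that the segments
    from [x] to [v] and from [v] to [y] fit in the resting times. *)
Lemma star_path x y g v : npath A x y g -> (forall t, v \in supp (g t)) ->
  nhom A x y g (pcat (seg x (vert v)) (seg (vert v) y)).
Proof.
move=> gP vg; have [_ gA g0 g1] := gP.
have Ax : A x by rewrite -(g0 0).
have Ay : A y by rewrite -(g1 1).
have vx : v \in supp x by rewrite -(g0 0).
have vy : v \in supp y by rewrite -(g1 1).
have [Av vxs _] := supp_vertP Ax vx; have [_ vys _] := supp_vertP Ay vy.
have xP := npath_seg Ax Av (realization_supp Ax) (fintype.subxx _) vxs.
have yP := npath_seg Av Ay (realization_supp Ay) vys (fintype.subxx _).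
apply: nhom_trans (nhom_sym (nhom_idl gP)) _.
apply: nhom_trans (nhom_pcat (nhom_refl (npath_cst Ax)) (nhom_sym (nhom_idr gP))) _.
apply: nhom_trans (nhom_pcat (nhom_refl xP) (nhom_idl yP)).
have cx := npath_cst Ax; have cy := npath_cst Ay; have cv := npath_cst Av.
have P1 := npath_pcat gP cy; have P2 := npath_pcat cv yP.
apply: nhom_contiguous => [||t]; [exact: npath_pcat cx P1|exact: npath_pcat xP P2|].
have [t1|t1] := leP (2 * t) 1.
  rewrite (pcatl cx P1)// (pcatl xP P2)//.
  exists (supp x); split => //; first exact: realization_supp.
  exact: (supp_seg _ Ax Av (realization_supp Ax)).
rewrite (pcatr cx P1) ?ltW// (pcatr xP P2) ?ltW//.
have [t2|t2] := leP (2 * (2 * t - 1)) 1.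
  rewrite (pcatl gP cy)// (pcatl cv yP)//; exists (supp (g (2 * (2 * t - 1)))).
  by split => //; [exact: realization_supp|rewrite supp_vert finset.sub1set].
rewrite (pcatr gP cy) ?ltW// (pcatr cv yP) ?ltW//; exists (supp y).
split => //; first exact: realization_supp.
exact: (supp_seg _ Av Ay (realization_supp Ay)).
Qed.

(** The open stars of the vertices cover the realization; the compactness of
    [0, 1] makes the scale at which [g] stays in one star uniform. *)
Lemma lebesgue_star x y g : npath A x y g -> exists2 d : R, 0 < d &
  forall t, 0 <= t <= 1 -> exists v, forall s, `|s - t| < d -> v \in supp (g s).
Proof.
move=> [gc gA _ _].
have /compact_near_coveringP/near_covering_withinP cov := @segment_compact R 0 1.
have := cov R (nbhs (0:R)^'+)
  (fun d t => exists v, forall s, `|s - t| < d -> v \in supp (g s)) _.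
case.
  move=> t _; have [v] := realization_supp0 (gA t); rewrite inE => gv.
  have cv : cts (fun s => g s ord0 v).
    by apply: (cont_comp (@coord_continuous R 1 n ord0 v) gc).
  have : \forall s \near t, g s ord0 v != 0.
    have := cv t => /(_ [set r | r != 0]); apply.
    by apply: open_nbhs_nbhs; split => //; exact: open_neq.
  move=> /nbhs_ballP[e /= e0 He].
  exists (ball t (e / 2), [set d : R | d < e / 2]) => /=.
    split; first by apply: nbhsx_ballx; rewrite divr_gt0.
    by apply: nbhs_right_lt; rewrite divr_gt0.
  move=> [t' d] /= [tt' de] _; exists v => s st'; rewrite inE.
  apply: He; rewrite /ball /= in tt' *.
  rewrite (le_lt_trans (ler_distD t' _ _))//.
  by rewrite (distrC t' s); lra.
move=> /= e; rewrite /= => e0 He.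
exists (e / 2); first by rewrite divr_gt0.
move=> t t01; apply: (He (e / 2)) => //=.
- by rewrite sub0r normrN gtr0_norm; lra.
- by lra.
Qed.

End Realization.

(** * Simple connectivity from fillings of triangles and squares *)

Section Trivialization.
Context {R : realType} {n : nat} (Y : {set {set 'I_n}}) (hY : subcomplex Y).
Local Notation V := 'rV[R]_n.
Local Notation A := (realization R Y).
Local Notation hom := (nhom A).
Local Notation "x --- y" := (seg (vert x) (vert y)) (at level 40).
Implicit Types (x y z : V) (s t : R) (u v w b c : 'I_n).

(** Adjacency inside the common neighbourhood of [u] and [w].  A vertex counts as
    its own neighbour ([[set u; u]] is [[set u]]), so that degenerate triangles
    and squares are included. *)
Definition common_edge u w v v' : bool :=
  [&& [set v; u]%SET \in Y, [set v; w]%SET \in Y, [set v'; u]%SET \in Y,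
      [set v'; w]%SET \in Y & [set v; v']%SET \in Y].

Hypothesis apexY : forall u v w,
  [set u]%SET \in Y -> [set v]%SET \in Y -> [set w]%SET \in Y ->
  exists c, [/\ [set c; u]%SET \in Y, [set c; v]%SET \in Y & [set c; w]%SET \in Y].
Hypothesis coneY : forall u v w,
  [set u; v]%SET \in Y -> [set v; w]%SET \in Y -> [set u; w]%SET \in Y ->
  exists c, [/\ [set c; u; v]%SET \in Y, [set c; v; w]%SET \in Y &
                [set c; u; w]%SET \in Y].
Hypothesis squareY : forall u w v v',
  [set v; u]%SET \in Y -> [set v; w]%SET \in Y ->
  [set v'; u]%SET \in Y -> [set v'; w]%SET \in Y ->
  connect (common_edge u w) v v'.

Lemma edge_vert u v : [set u; v]%SET \in Y -> [set u]%SET \in Y.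
Proof.
move=> uvY; apply: (subcomplexW hY uvY); last by rewrite finset.subsetUl.
by apply/set0Pn; exists u; rewrite inE.
Qed.

Lemma edge_vertr u v : [set u; v]%SET \in Y -> [set v]%SET \in Y.
Proof. by rewrite finset.setUC; exact: edge_vert. Qed.

Lemma edge_sym u v : ([set u; v]%SET \in Y) = ([set v; u]%SET \in Y).
Proof. by rewrite finset.setUC. Qed.

Lemma edge_path u v : [set u; v]%SET \in Y -> npath A (vert u) (vert v) (u --- v).
Proof.
move=> uvY; apply: (npath_seg hY _ _ uvY); rewrite ?supp_vert.
- exact: (vert_in (edge_vert uvY)).
- exact: (vert_in (edge_vertr uvY)).
- exact: finset.subsetUl.
- exact: finset.subsetUr.
Qed.

Lemma simplex_triangle u v w (T : {set 'I_n}) : T \in Y ->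
  u \in T -> v \in T -> w \in T ->
  hom (vert u) (vert w) (pcat (u --- v) (v --- w)) (u --- w).
Proof.
move=> TY uT vT wT.
have inT i : i \in T -> A (vert i : V).
  move=> iT; apply: vert_in; apply: (subcomplexW hY TY).
    by apply/set0Pn; exists i; rewrite inE.
  by rewrite finset.sub1set.
by apply: (seg_triangle hY _ _ _ TY); rewrite ?supp_vert ?finset.sub1set//; exact: inT.
Qed.

(** Coning from the apex [c] replaces [u - v - w] by [u - c - v - c - w], whose
    detour to [v] cancels. *)
Lemma edge_triangle u v w :
  [set u; v]%SET \in Y -> [set v; w]%SET \in Y -> [set u; w]%SET \in Y ->
  hom (vert u) (vert w) (pcat (u --- v) (v --- w)) (u --- w).
Proof.
move=> uv vw uw; have [c [cuv cvw cuw]] := coneY uv vw uw.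
have sub (a b d : 'I_n) : [set a; b; d]%SET \in Y -> forall i j,
    i \in [set a; b; d]%SET -> j \in [set a; b; d]%SET -> [set i; j]%SET \in Y.
  move=> abd i j iT jT; apply: (subcomplexW hY abd).
    by apply/set0Pn; exists i; rewrite !inE eqxx.
  by apply/fintype.subsetP => k; rewrite in_set2 => /orP[] /eqP ->.
have uc : [set u; c]%SET \in Y by apply: (sub _ _ _ cuv); rewrite !inE eqxx ?orbT.
have cv : [set c; v]%SET \in Y by apply: (sub _ _ _ cuv); rewrite !inE eqxx ?orbT.
have vc : [set v; c]%SET \in Y by rewrite edge_sym.
have cw : [set c; w]%SET \in Y by apply: (sub _ _ _ cvw); rewrite !inE eqxx ?orbT.
have cc : [set c; c]%SET \in Y by apply: (sub _ _ _ cuv); rewrite !inE eqxx ?orbT.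
have e1 : hom (vert u) (vert v) (u --- v) (pcat (u --- c) (c --- v)).
  by apply/nhom_sym/(simplex_triangle cuv); rewrite !inE eqxx ?orbT.
have e2 : hom (vert v) (vert w) (v --- w) (pcat (v --- c) (c --- w)).
  by apply/nhom_sym/(simplex_triangle cvw); rewrite !inE eqxx ?orbT.
apply: nhom_trans (nhom_pcat e1 e2) _.
apply: nhom_trans (nhom_assoc (edge_path uc) (edge_path cv)
  (npath_pcat (edge_path vc) (edge_path cw))) _.
have e3 : hom (vert c) (vert w)
    (pcat (c --- v) (pcat (v --- c) (c --- w))) (c --- w).
  apply: nhom_trans (nhom_sym (nhom_assoc (edge_path cv) (edge_path vc) (edge_path cw))) _.
  have e4 : hom (vert c) (vert c) (pcat (c --- v) (v --- c)) (c --- c).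
    by apply: (simplex_triangle cv); rewrite !inE eqxx ?orbT.
  apply: nhom_trans (nhom_pcat e4 (nhom_refl (edge_path cw))) _.
  by apply: (simplex_triangle cw); rewrite !inE eqxx ?orbT.
apply: nhom_trans (nhom_pcat (nhom_refl (edge_path uc)) e3) _.
by apply: (simplex_triangle cuw); rewrite !inE eqxx ?orbT.
Qed.

(** Moving the middle vertex along one edge of the common neighbourhood crosses
    two triangles. *)
Lemma edge_square u w v v' :
  [set v; u]%SET \in Y -> [set v; w]%SET \in Y ->
  [set v'; u]%SET \in Y -> [set v'; w]%SET \in Y ->
  hom (vert u) (vert w) (pcat (u --- v) (v --- w)) (pcat (u --- v') (v' --- w)).
Proof.
move=> vu vw v'u v'w; have /connectP[p] := squareY vu vw v'u v'w.
elim: p v vu vw => [|y p IH] v vu vw /= => [_ ->|/andP[/and5P[_ _ yu yw vy] py] e].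
  by apply: nhom_refl; apply: npath_pcat (edge_path _) (edge_path _) => //; rewrite edge_sym.
apply: nhom_trans (IH y yu yw py e).
have uv : [set u; v]%SET \in Y by rewrite edge_sym.
have uy : [set u; y]%SET \in Y by rewrite edge_sym.
have yv : [set y; v]%SET \in Y by rewrite edge_sym.
apply: nhom_trans (nhom_pcat (nhom_sym (edge_triangle uy yv uv)) (nhom_refl (edge_path vw))) _.
apply: nhom_trans (nhom_assoc (edge_path uy) (edge_path yv) (edge_path vw)) _.
exact: nhom_pcat (nhom_refl (edge_path uy)) (edge_triangle yv vw yw).
Qed.

Variable b : 'I_n.
Hypothesis bY : [set b]%SET \in Y.

(** All radial paths to [v] are homotopic, by [edge_square]; they single out one
    homotopy class of paths from [b] to [v]. *)
Definition radial v (f : R -> V) := exists c,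
  [/\ [set b; c]%SET \in Y, [set c; v]%SET \in Y & f = pcat (b --- c) (c --- v)].

Lemma radial_path v f : radial v f -> npath A (vert b) (vert v) f.
Proof. by case=> c [bc cv ->]; exact: npath_pcat (edge_path bc) (edge_path cv). Qed.

(** A common neighbour [z] of [b], [v] and [v'] serves as middle vertex for both
    endpoints; the triangle [z v v'] then relates the two. *)
Lemma radial_edge v v' f f' : radial v f -> radial v' f' ->
  [set v; v']%SET \in Y -> hom (vert b) (vert v') (pcat f (v --- v')) f'.
Proof.
case=> c [bc cv ->] [c' [bc' c'v' ->]] vv'.
have [z [zb zv zv']] := apexY bY (edge_vert vv') (edge_vertr vv').
have bz : [set b; z]%SET \in Y by rewrite edge_sym.
have e1 : hom (vert b) (vert v) (pcat (b --- c) (c --- v)) (pcat (b --- z) (z --- v)).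
  by apply: edge_square => //; rewrite edge_sym.
have e2 : hom (vert b) (vert v') (pcat (b --- z) (z --- v')) (pcat (b --- c') (c' --- v')).
  by apply: edge_square => //; rewrite edge_sym.
apply: nhom_trans (nhom_pcat e1 (nhom_refl (edge_path vv'))) _.
apply: nhom_trans (nhom_assoc (edge_path bz) (edge_path zv) (edge_path vv')) _.
apply: nhom_trans e2.
exact: nhom_pcat (nhom_refl (edge_path bz)) (edge_triangle zv vv' zv').
Qed.

(** The extension of the radial class from vertices to all points of the
    realization. *)
Definition radial_to x (f : R -> V) := exists v g,
  [/\ v \in supp x, radial v g & hom (vert b) x f (pcat g (seg (vert v) x))].

Lemma radial_exists v : [set v]%SET \in Y -> exists f, radial v f.
Proof.
move=> vY; have [c [cb cv _]] := apexY bY vY vY.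
by exists (pcat (b --- c) (c --- v)); exists c; rewrite edge_sym.
Qed.

Lemma seg_from_vert x v : A x -> v \in supp x -> npath A (vert v) x (seg (vert v) x).
Proof.
move=> Ax vx; have [Av vs _] := supp_vertP hY Ax vx.
exact: (npath_seg hY Av Ax (realization_supp Ax)).
Qed.

Lemma radial_to_exists x : A x -> exists f, radial_to x f.
Proof.
move=> Ax; have [v vx] := realization_supp0 hY Ax.
have [_ _ vY] := supp_vertP hY Ax vx; have [g gr] := radial_exists vY.
exists (pcat g (seg (vert v) x)), v, g; split => //.
exact/nhom_refl/(npath_pcat (radial_path gr))/seg_from_vert.
Qed.

(** The last vertex of a representative may be any vertex of the open simplex of
    [x], since two such vertices span an edge with the segments to [x]
    filling a triangle. *)
Lemma radial_to_vert x f v : A x -> radial_to x f -> v \in supp x ->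
  exists2 g, radial v g & hom (vert b) x f (pcat g (seg (vert v) x)).
Proof.
move=> Ax [u [g [ux gr fg]]] vx.
have [Av vs vY] := supp_vertP hY Ax vx; have [Au us _] := supp_vertP hY Ax ux.
have [h hr] := radial_exists vY; exists h => //.
have uv : [set u; v]%SET \in Y.
  apply: (subcomplexW hY (realization_supp Ax)).
    by apply/set0Pn; exists u; rewrite !inE eqxx.
  by apply/fintype.subsetP => k; rewrite in_set2 => /orP[] /eqP ->.
have vxP := seg_from_vert Ax vx.
apply: nhom_trans fg _.
apply: nhom_trans (nhom_pcat (radial_edge gr hr uv) (nhom_refl vxP)).
apply: nhom_trans (nhom_sym (nhom_assoc (radial_path gr) (edge_path uv) vxP)).
apply: nhom_pcat (nhom_refl (radial_path gr)) _; apply: nhom_sym.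
exact: (seg_triangle hY Au Av Ax (realization_supp Ax)).
Qed.

Lemma radial_to_unique x f g : A x -> radial_to x f -> radial_to x g ->
  hom (vert b) x f g.
Proof.
move=> Ax fr gr; have [v vx] := realization_supp0 hY Ax.
have [f' [c [bc cv ->]] ff'] := radial_to_vert Ax fr vx.
have [g' [c' [bc' c'v ->]] gg'] := radial_to_vert Ax gr vx.
apply: nhom_trans ff' _; apply: nhom_trans (nhom_sym gg').
apply: nhom_pcat (nhom_refl (seg_from_vert Ax vx)).
by apply: edge_square => //; rewrite edge_sym.
Qed.

Lemma radial_to_npath x f : A x -> radial_to x f -> npath A (vert b) x f.
Proof. by move=> Ax [u [g [_ _ /nhom_npathl]]]. Qed.

Lemma radial_to_star x y f g v : npath A x y g ->
  (forall t, v \in supp (g t)) -> radial_to x f -> radial_to y (pcat f g).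
Proof.
move=> gP gv fr; have [_ gA g0 g1] := gP.
have Ax : A x by rewrite -(g0 0).
have Ay : A y by rewrite -(g1 1).
have vx : v \in supp x by rewrite -(g0 0).
have vy : v \in supp y by rewrite -(g1 1).
have [h hr fh] := radial_to_vert Ax fr vx.
have [Av vxs vY] := supp_vertP hY Ax vx; have [_ vys _] := supp_vertP hY Ay vy.
exists v, h; split => //.
have hP := radial_path hr; have vxP := seg_from_vert Ax vx.
have vyP := seg_from_vert Ay vy.
have xvP := npath_seg hY Ax Av (realization_supp Ax) (fintype.subxx _) vxs.
apply: nhom_trans (nhom_pcat fh (star_path hY gP gv)) _.
apply: nhom_trans (nhom_assoc hP vxP (npath_pcat xvP vyP)) _.
apply: nhom_pcat (nhom_refl hP) _.
apply: nhom_trans (nhom_sym (nhom_assoc vxP xvP vyP)) _.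
have e : hom (vert v) (vert v) (pcat (seg (vert v) x) (seg x (vert v))) (v --- v).
  exact: (seg_triangle hY Av Ax Av (realization_supp Ax)).
apply: nhom_trans (nhom_pcat e (nhom_refl vyP)) _.
exact: (seg_triangle hY Av Av Ay (realization_supp Ay)).
Qed.

(** Transport of radial classes along arbitrary paths, by repeated halving until
    each piece stays in one open star. *)
Lemma radial_to_pcat x y f g : npath A x y g -> radial_to x f ->
  radial_to y (pcat f g).
Proof.
move=> gP; have [d d0 Hd] := lebesgue_star hY gP.
have [m dm] : exists m : nat, 1 < 2 ^+ m * d.
  have [m _ Hm] := near_infty_natSinv_expn_lt (PosNum d0).
  exists m; have := Hm m (leqnn _); rewrite /=.
  by rewrite ltr_pdivrMr ?exprn_gt0// mulrC.
elim: m x y f g d d0 dm gP Hd => [|m IH] x y f g d d0 dm gP Hd fr.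
  rewrite expr0 mul1r in dm; have [|v Hv] := Hd 0; first by rewrite lexx ler01.
  have [_ _ g0 g1] := gP; apply: (radial_to_star gP (v := v)) fr => t.
  have [t0|t0] := leP t 0; first by rewrite g0// -(g0 0)//; apply: Hv; rewrite subr0 normr0.
  have [t1|t1] := leP 1 t.
    by rewrite g1// -(g1 1)//; apply: Hv; rewrite subr0 normr1.
  by apply: Hv; rewrite subr0 gtr0_norm// (lt_trans t1).
have [gc gA g0 g1] := gP.
pose g1' (t : R) := g (2^-1 * clamp t).
pose g2' (t : R) := g (2^-1 + 2^-1 * clamp t).
have g1P : npath A x (g 2^-1) g1'.
  rewrite /g1'; split; [by cont|by move=> t; exact: gA| |].
    by move=> t /clamp_le0 ->; rewrite mulr0 g0.
  by move=> t /clamp_ge1 ->; rewrite mulr1.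
have g2P : npath A (g 2^-1) y g2'.
  rewrite /g2'; split; [by cont|by move=> t; exact: gA| |].
    by move=> t /clamp_le0 ->; rewrite mulr0 addr0.
  by move=> t /clamp_ge1 ->; rewrite mulr1 g1//; lra.
have gE : g = pcat g1' g2'.
  apply/funext => t; have [t2|t2] := leP (2 * t) 1.
    rewrite (pcatl g1P g2P)// /g1'; have [t0|t0] := leP t 0.
      by rewrite clamp_le0 ?mulr0 ?g0//; lra.
    by rewrite clamp_id ?mulKf//; lra.
  rewrite (pcatr g1P g2P) ?ltW// /g2'; have [t1|t1] := leP 1 t.
    by rewrite clamp_ge1 ?g1//; lra.
  by rewrite clamp_id; [congr g; lra|lra].
have d2 : 0 < 2 * d by rewrite mulr_gt0.
have dm2 : 1 < 2 ^+ m * (2 * d) by rewrite mulrA -exprSr.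
have H1 : forall t, 0 <= t <= 1 -> exists v, forall s, `|s - t| < 2 * d -> v \in supp (g1' s).
  move=> t t01; have [|v Hv] := Hd (2^-1 * clamp t); first by rewrite clamp_id//; lra.
  exists v => s st; apply: Hv; rewrite -mulrBr normrM gtr0_norm//.
  by have := clamp_lipschitz s t; lra.
have H2 : forall t, 0 <= t <= 1 -> exists v, forall s, `|s - t| < 2 * d -> v \in supp (g2' s).
  move=> t t01; have [|v Hv] := Hd (2^-1 + 2^-1 * clamp t); first by rewrite clamp_id//; lra.
  exists v => s st; apply: Hv; rewrite opprD addrACA subrr add0r -mulrBr normrM gtr0_norm//.
  by have := clamp_lipschitz s t; lra.
have Ax : A x by rewrite -(g0 0).
have Ay : A y by rewrite -(g1 1).
have r1 := IH _ _ _ _ _ d2 dm2 g1P H1 fr.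
have [v [h [vy hr e]]] := IH _ _ _ _ _ d2 dm2 g2P H2 r1.
exists v, h; split => //; apply: nhom_trans e; rewrite {1}gE.
exact/nhom_sym/(nhom_assoc (radial_to_npath Ax fr) g1P g2P).
Qed.

Lemma npath_pi1 x g : A x -> npath A x x g -> hom x x g (cst x).
Proof.
move=> Ax gP; have [f fr] := radial_to_exists Ax.
apply: (nhom_cancel (radial_to_npath Ax fr) gP).
exact: radial_to_unique (radial_to_pcat gP fr) fr.
Qed.

Lemma npath_connected x y : A x -> A y -> exists g, npath A x y g.
Proof.
move=> Ax Ay; have [f fr] := radial_to_exists Ax; have [g gr] := radial_to_exists Ay.
exists (pcat (prev f) g).
exact: npath_pcat (npath_prev (radial_to_npath Ax fr)) (radial_to_npath Ay gr).
Qed.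

Lemma npath_clamp x y g : is_path R A x y g -> npath A x y (g \o clamp).
Proof.
move=> [/subspace_continuousP gc gA g0 g1]; split => /=.
- move=> t; have ct : clamp s @[s --> t] --> clamp t by exact: (cont_clamp (@cont_id R)).
  have cl s : clamp s \in `[0, 1]%R by rewrite in_itv /= clamp_itv.
  have := gc _ (cl t : [set` `[0, 1]%R] (clamp t)); apply: cvg_comp => P Pn.
  have : nbhs t (clamp @^-1` [set s | s \in `[0, 1]%R -> P s]) by exact: (ct _ Pn).
  by apply: filterS => s /(_ (cl s)).
- by move=> t; apply: gA; rewrite in_itv /= clamp_itv.
- by move=> t /clamp_le0 ->.
- by move=> t /clamp_ge1 ->.
Qed.

Lemma npath_is_path x y g : npath A x y g -> is_path R A x y g.
Proof.
move=> [gc gA g0 g1]; split => //; [|exact: g0|exact: g1].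
exact: continuous_subspaceT.
Qed.

Lemma realization_simply_connected : simply_connected R A.
Proof.
split.
- by exists (vert b); exact: vert_in.
- by move=> x y Ax Ay; have [g /npath_is_path] := npath_connected Ax Ay; exists g.
- move=> x Ax g /npath_clamp gP; have [H [Hc HP H0 H1]] := npath_pi1 Ax gP.
  exists H; split.
  + exact: continuous_subspaceT.
  + move=> t; rewrite in_itv /= => t01.
    by rewrite H0//= clamp_id// H1.
  + by move=> s _; apply: npath_is_path; exact: HP.
Qed.

End Trivialization.

(** * Independent coins indexed by a finite set *)

Section ProductMeasure.
Local Close Scope classical_set_scope.
Context {R : realType} {I : finType} (q : I -> R).
Hypothesis q01 : forall i, 0 <= q i <= 1.
Implicit Types (A B D : {set I}) (E F G : pred {set I}).

Definition wt A : R := \prod_i (if i \in A then q i else 1 - q i).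

Definition pr E : R := \sum_(A | E A) wt A.

Lemma wt_ge0 A : 0 <= wt A.
Proof.
by apply: prodr_ge0 => i _; have /andP[? ?] := q01 i; case: ifP => // _; lra.
Qed.

Lemma sum_wt : \sum_A wt A = 1.
Proof.
rewrite -(bigA_distr _ _ q (fun i => 1 - q i)) big1 // => i _.
by rewrite /= addrCA subrr addr0.
Qed.

Lemma prE E : pr E = \sum_A wt A * (E A)%:R.
Proof.
rewrite /pr [LHS]big_mkcond; apply: eq_bigr => A _.
by case: (E A); rewrite ?mulr1 ?mulr0.
Qed.

Lemma pr_ge0 E : 0 <= pr E.
Proof. by apply: sumr_ge0 => A _; exact: wt_ge0. Qed.

Lemma eq_pr E F : E =1 F -> pr E = pr F.
Proof. by move=> EF; apply: eq_bigl. Qed.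

Lemma pr_mono E F : (forall A, E A -> F A) -> pr E <= pr F.
Proof.
move=> EF; rewrite !prE; apply: ler_sum => A _; apply: ler_wpM2l; first exact: wt_ge0.
by rewrite ler_nat; case: (E A) (EF A) => // ->.
Qed.

Lemma prC E : pr (fun A => ~~ E A) = 1 - pr E.
Proof.
by rewrite -sum_wt (bigID E) /= addrAC subrr add0r.
Qed.

Lemma pr_union (X : finType) (P : pred X) (E : X -> pred {set I}) :
  pr (fun A => [exists x in P, E x A]) <= \sum_(x in P) pr (E x).
Proof.
under eq_bigr do rewrite prE.
rewrite exchange_big /= prE; apply: ler_sum => A _; rewrite -mulr_sumr.
apply: ler_wpM2l; first exact: wt_ge0.
case: existsP => [[x /andP[xP ExA]]|_]; last by apply: sumr_ge0.
rewrite (bigD1 x) //= ExA lerDl; exact: sumr_ge0.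
Qed.

Lemma pr_cylinder B D : [disjoint B & D] ->
  pr (fun A => (B \subset A) && [disjoint D & A]) =
  \prod_(i in B) q i * \prod_(i in D) (1 - q i).
Proof.
move=> BD.
pose f i := if i \in D then 0 else q i.
pose g i := if i \in B then 0 else 1 - q i.
have -> : pr (fun A => (B \subset A) && [disjoint D & A]) =
    \sum_(A : {set I}) \prod_i (if i \in A then f i else g i).
  rewrite prE; apply: eq_bigr => A _; have [|H] := boolP (_ && _).
    move=> /andP[/fintype.subsetP BA DA]; rewrite mulr1; apply: eq_bigr => i _.
    rewrite /f /g; case: ifP => iA.
      by case: ifP => // /(disjointFr DA); rewrite iA.
    by case: ifP => // /BA; rewrite iA.
  rewrite mulr0; case/nandP: H => [/subsetPn[i iB iA]|/pred0Pn[i /andP[/= iD iA]]].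
    by rewrite (bigD1 i) //= (negbTE iA) /g iB mul0r.
  by rewrite (bigD1 i) //= iA /f iD mul0r.
rewrite -(bigA_distr _ _ f g).
rewrite (big_mkcond (mem B)) (big_mkcond (mem D)) -big_split /=; apply: eq_bigr => i _.
rewrite /f /g; case: ifP => iD; case: ifP => iB; rewrite ?mulr1 ?mul1r ?addr0 ?add0r //.
- by have := disjointFr BD iB; rewrite iD.
- by rewrite addrCA subrr addr0.
Qed.

Lemma pr_superset B : pr (fun A => B \subset A) = \prod_(i in B) q i.
Proof.
have := @pr_cylinder B finset.set0; rewrite big_set0 mulr1 => <-.
  apply: eq_pr => A; rewrite (_ : [disjoint _ & A]) ?andbT//.
  by rewrite finset.disjoints_subset finset.sub0set.
by rewrite disjoint_sym finset.disjoints_subset finset.sub0set.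
Qed.

Definition depends_on D E := forall A, E A = E (A :&: D)%SET.

(** On two independent copies [(A, B)] of the random set, exchanging the parts
    outside [D] preserves the joint law; it turns the event that [E] holds of
    [A] and [F] of [B] into the event that both hold of [A]. *)
Lemma pr_indep D E F : depends_on D E -> depends_on (~: D)%SET F ->
  pr (fun A => E A && F A) = pr E * pr F.
Proof.
move=> ED FD; rewrite -[LHS]mulr1 -sum_wt !prE !big_distrlr /= !pair_bigA /=.
pose h (p : {set I} * {set I}) : {set I} * {set I} :=
  ((p.1 :&: D) :|: (p.2 :&: ~: D), (p.2 :&: D) :|: (p.1 :&: ~: D))%SET.
have hK : involutive h.
  move=> [A B]; rewrite /h /=; congr pair; apply/setP => i; rewrite !inE;
    by case: (i \in D); case: (i \in A); case: (i \in B).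
rewrite (reindex_inj (inv_inj hK)) /=; apply: eq_bigr => p _.
have hw : wt (h p).1 * wt (h p).2 = wt p.1 * wt p.2.
  rewrite -!big_split; apply: eq_bigr => i _; rewrite !inE /=.
  by case: (i \in D); rewrite ?andbT ?andbF ?orbF ?orFb //= mulrC.
have hE : E (h p).1 = E p.1.
  rewrite ED [RHS]ED; congr E; apply/setP => i; rewrite !inE.
  by case: (i \in D); rewrite ?andbT ?andbF ?orbF.
have hF : F (h p).1 = F p.2.
  rewrite FD [RHS]FD; congr F; apply/setP => i; rewrite !inE.
  by case: (i \in D); rewrite ?andbT ?andbF ?orbF.
by rewrite [LHS]mulrAC hw hE hF -mulnb natrM; ring.
Qed.

Lemma depends_onW B D E : B \subset D -> depends_on B E -> depends_on D E.
Proof.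
by move=> /finset.setIidPr BD EB A; rewrite EB [RHS]EB -finset.setIA BD.
Qed.

Lemma depends_onC D E : depends_on D E -> depends_on D (fun A => ~~ E A).
Proof. by move=> ED A; rewrite ED. Qed.

Lemma pr_none (X : eqType) (s : seq X) (D : X -> {set I}) (E : X -> pred {set I}) :
  uniq s -> (forall x, x \in s -> depends_on (D x) (E x)) ->
  (forall x y, x \in s -> y \in s -> x != y -> [disjoint D x & D y]) ->
  pr (fun A => all (fun x => ~~ E x A) s) = \prod_(x <- s) (1 - pr (E x)).
Proof.
elim: s => [|x s IH] /=.
  by move=> _ _ _; rewrite big_nil -sum_wt; apply: eq_bigl.
move=> /andP[xs us] ED dis; rewrite big_cons -IH //; last first.
- by move=> y z ys zs; apply: dis; rewrite inE ?ys ?zs orbT.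
- by move=> y ys; apply: ED; rewrite inE ys orbT.
rewrite -prC; apply: (@pr_indep (D x)).
  by apply: depends_onC; apply: ED; rewrite inE eqxx.
move=> A; apply: eq_in_all => y ys; congr (~~ _).
have yD : D y \subset (~: D x)%SET.
  rewrite -finset.disjoints_subset; apply: dis; rewrite ?inE ?eqxx ?ys ?orbT//.
  by apply: contraNneq xs => <-.
by apply: (depends_onW yD (ED y _)); rewrite inE ys orbT.
Qed.

End ProductMeasure.

(** * The random complex as a function of independent coins *)

Section Pushforward.
Local Close Scope classical_set_scope.
Context {R : realType} {r n : nat} (p : 'I_r.+1 -> R).
Hypothesis p01 : forall i, 0 <= p i <= 1.
Implicit Types (w Y : {set {set 'I_n}}) (s t : {set 'I_n}).

Definition face_prob s : R := p (inord #|s|.-1).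

Lemma face_prob01 s : 0 <= face_prob s <= 1. Proof. exact: p01. Qed.

(** The largest complex of dimension at most [r] whose simplexes all belong to
    [w]. *)
Definition full_complex w : {set {set 'I_n}} :=
  [set s : {set 'I_n} | [&& s != finset.set0, (#|s| <= r.+1)%N &
    [forall t : {set 'I_n}, (t != finset.set0) && (t \subset s) ==> (t \in w)]]]%SET.

Definition small_external Y : {set {set 'I_n}} :=
  [set s : {set 'I_n} | [&& s != finset.set0, (#|s| <= r.+1)%N & external_face Y s]]%SET.

Lemma full_complexP w s : reflect
  [/\ s != finset.set0, (#|s| <= r.+1)%N &
      forall t, t != finset.set0 -> t \subset s -> t \in w]%N
  (s \in full_complex w).
Proof.
rewrite inE; apply: (iffP and3P) => -[s0 sr H]; split => //.
  by move=> t t0 ts; move/forallP/(_ t): H; rewrite t0 ts.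
by apply/forallP => t; apply/implyP => /andP[]; exact: H.
Qed.

Lemma full_complex_subcomplex w : subcomplex (full_complex w).
Proof.
apply/andP; split; first by rewrite inE eqxx.
apply/forall_inP => s /full_complexP[s0 sr H]; apply/forallP => t.
apply/implyP => /andP[t0 ts]; apply/full_complexP; split => //.
  by rewrite (leq_trans (subset_leq_card ts)).
by move=> u u0 ut; apply: H => //; exact: fintype.subset_trans ts.
Qed.

Lemma full_complex_Omega w : full_complex w \in Omega n r.
Proof.
rewrite inE full_complex_subcomplex; apply/forall_inP => s.
by case/full_complexP.
Qed.

(** If all faces of [Y] and no external face belong to [w], a simplex of the
    complex of [w] of least size outside [Y] would be external. *)
Lemma full_complex_eq w Y : Y \in Omega n r ->
  (full_complex w == Y) = (Y \subset w) && [disjoint small_external Y & w].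
Proof.
rewrite inE => /andP[hY /forall_inP Yr].
have Y0 s : s \in Y -> s != finset.set0.
  by move=> sY; apply: contraTneq hY => s0; rewrite /subcomplex -s0 sY.
apply/eqP/andP => [<-|[/fintype.subsetP Yw ext]].
  split.
    by apply/fintype.subsetP => s /full_complexP[s0 _]; apply.
  apply/pred0P => s; apply/negbTE/negP => /= /andP[].
  rewrite inE => /and3P[s0 sr /andP[/negP sK /forallP H]] sw.
  apply: sK; apply/full_complexP; split => // t t0 ts.
  have [->//|tns] := eqVneq t s.
  have := H t; rewrite t0 finset.properEneq tns ts => /full_complexP[_ _]; exact.
apply/setP => s; apply/idP/idP => [|sY]; last first.
  apply/full_complexP; split; [exact: Y0|exact: Yr|move=> t t0 ts].
  exact/Yw/(subcomplexW hY sY).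
have [m] := ubnP #|s|; elim: m s => // m IH s /ltnSE sm sK.
have [s0 sr H] := full_complexP _ _ sK.
apply: contraT => sY; have sw : s \in w by exact: H.
suff : s \in small_external Y by move=> /(disjointFr ext); rewrite sw.
rewrite inE s0 sr /external_face sY; apply/forallP => t; apply/implyP => /andP[t0 ts].
apply: IH; first exact: leq_trans (proper_card ts) sm.
have := full_complex_subcomplex w => /subcomplexW; apply; [exact: sK|exact: t0|].
exact: proper_sub.
Qed.

Lemma Pweight_pr Y : Y \in Omega n r ->
  Pweight p Y = pr face_prob (fun w => full_complex w == Y).
Proof.
move=> YO; under eq_pr do rewrite full_complex_eq//.
have /andP[hY /forall_inP Yr] : subcomplex Y && [forall s in Y, #|s| <= r.+1]%N.
  by move: YO; rewrite inE.
have Y0 s : s \in Y -> s != finset.set0.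
  by move=> sY; apply: contraTneq hY => s0; rewrite /subcomplex -s0 sY.
rewrite pr_cylinder; last first.
  apply/pred0P => s; apply/negbTE/negP => /= /andP[sY].
  by rewrite inE => /and3P[_ _ /andP[]]; rewrite sY.
have ordE (i : 'I_r.+1) s : #|s| = i.+1 -> inord #|s|.-1 = i.
  by move=> ->; rewrite inord_val.
have split_card (B : {set {set 'I_n}}) (f : 'I_r.+1 -> R) :
    (forall s, s \in B -> s != finset.set0 /\ (#|s| <= r.+1)%N) ->
    \prod_(s in B) f (inord #|s|.-1) =
    \prod_(i < r.+1) f i ^+ #|[set s in B | #|s| == i.+1]%SET|.
  move=> HB; rewrite (partition_big (fun s => inord #|s|.-1 : 'I_r.+1) predT)//=.
  apply: eq_bigr => i _; rewrite -prodr_const; apply: eq_big => s;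
    last by case/andP=> _ /eqP ->.
  rewrite inE; have [sB|//] := boolP (s \in B); have [s0 sr] := HB _ sB.
  rewrite -val_eqE /= inordK; last by rewrite prednK ?card_gt0.
  by rewrite -(@prednK #|s|) ?card_gt0// eqSS.
congr (_ * _).
  by rewrite split_card// => s sY; split; [exact: Y0|exact: Yr].
rewrite (split_card _ (fun i => 1 - p i)); last by move=> s; rewrite inE => /and3P[].
apply: eq_bigr => i _; congr (_ ^+ _); apply: eq_card => s.
rewrite !inE; have [si|] := eqVneq #|s| i.+1; last by rewrite andbF.
by rewrite andbT -card_gt0 si ltn_ord.
Qed.

Lemma Prob_pr (E : {set {set 'I_n}} -> Prop) :
  Prob p E = pr face_prob (fun w => `[< E (full_complex w) >]).
Proof.
rewrite /Prob /pr [RHS](partition_big full_complex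
  (fun Y => (Y \in Omega n r) && `[< E Y >])) /=.
  apply: eq_bigr => Y /andP[YO EY]; rewrite Pweight_pr// /pr.
  apply: eq_bigl => w; have [->|_] := eqVneq (full_complex w) Y; last by rewrite andbF.
  by rewrite EY.
by move=> w ->; rewrite full_complex_Omega.
Qed.

End Pushforward.

(** * A deterministic criterion for simple connectivity *)

Section GoodComplex.
Local Close Scope classical_set_scope.
Context {n : nat}.
Implicit Types (w Y : {set {set 'I_n}}) (S T s t : {set 'I_n}) (u v x y z : 'I_n).

Lemma card_subset_exists (X : finType) (B : {set X}) k : (k <= #|B|)%N ->
  exists2 A : {set X}, A \subset B & #|A| = k.
Proof.
move=> kB; have : (0 < #|[set A : {set X} | A \subset B & #|A| == k]%SET|)%N.
  by rewrite cards_draws bin_gt0.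
by case/card_gt0P => A; rewrite inE => /andP[AB /eqP Ak]; exists A.
Qed.

Lemma card_superset_exists (X : finType) (B : {set X}) k : (#|B| <= k <= #|X|)%N ->
  exists2 A : {set X}, B \subset A & #|A| = k.
Proof.
move=> /andP[Bk kX]; have := cardsC B => cB.
have [|A AB Ak] := @card_subset_exists X (~: B)%SET (k - #|B|); first lia.
exists (B :|: A)%SET; first exact: finset.subsetUl.
rewrite cardsU (_ : B :&: A = finset.set0)%SET ?cards0; first lia.
by apply/eqP; rewrite setI_eq0 disjoint_sym finset.disjoints_subset.
Qed.

Lemma card_set3_le (X : finType) (u v x : X) : (#|[set u; v; x]%SET| <= 3)%N.
Proof.
by rewrite cardsU cards1 cards2 (leq_trans (leq_subr _ _))// addn1 !ltnS leq_b1.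
Qed.

(** The faces [z |: t] for [#|t| < 3] are the 1 + 3 + 3 simplexes of the cone with
    apex [z] over the boundary of the triangle [T]. *)
Definition cones w := [forall T : {set 'I_n}, (#|T| == 3%N) ==>
  [exists z, (z \notin T) && [forall t : {set 'I_n},
    (t \subset T) && (#|t| < 3)%N ==> ((z |: t)%SET \in w)]]].

(** The condition ranges over all vertex sets [S], whether or not they lie in the
    common neighbourhood: its probability is then free of conditioning. *)
Definition expands_at u x S w := [exists z, [&& z \notin u |: (x |: S)%SET,
  [set z]%SET \in w, [set z; u]%SET \in w, [set z; x]%SET \in w &
  [exists y in S, [set z; y]%SET \in w]]].

Definition expands m w := [forall u, forall x, forall S : {set 'I_n},
  [&& (0 < #|S|)%N, (#|S| <= m)%N, u \notin S & x \notin S] ==> expands_at u x S w].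

Definition joined_at S T w := [exists y in S, exists z in T, [set y; z]%SET \in w].

Definition joined m w := [forall S : {set 'I_n}, forall T : {set 'I_n},
  [&& #|S| == m, #|T| == m & [disjoint S & T]] ==> joined_at S T w].

Section Deterministic.
Variables (r m : nat) (w : {set {set 'I_n}}).
Hypotheses (r2 : (2 <= r)%N) (n3 : (3 <= n)%N).
Hypotheses (Hcone : cones w) (Hexp : expands m w) (Hjoin : joined m w).
Local Notation Y := (full_complex (r := r) w).

Lemma full_complex_face s : s != finset.set0 -> (#|s| <= r.+1)%N -> s \in w ->
  (forall i t, i \in s -> t != finset.set0 -> t \subset s -> i \notin t -> t \in Y) ->
  s \in Y.
Proof.
move=> s0 sr sw H; apply/full_complexP; split => // t t0 ts.
have [->//|tns] := eqVneq t s.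
have : t \proper s by rewrite finset.properEneq tns.
case/properP => _ [i si it]; have /full_complexP[_ _] := H i t si t0 ts it.
exact.
Qed.

Lemma vertex_in v : [set v]%SET \in w -> [set v]%SET \in Y.
Proof.
move=> vw; apply: full_complex_face => //.
- by apply/set0Pn; exists v; rewrite inE.
- by rewrite cards1.
- move=> i t; rewrite inE => /eqP -> t0; rewrite finset.subset1 (negbTE t0) orbF.
  by move=> /eqP ->; rewrite inE eqxx.
Qed.

Lemma edge_in u v : [set u]%SET \in Y -> [set v]%SET \in Y ->
  [set u; v]%SET \in w -> [set u; v]%SET \in Y.
Proof.
move=> uY vY uvw; apply: full_complex_face => //.
- by apply/set0Pn; exists u; rewrite !inE eqxx.
- by rewrite cards2; case: (_ == _) => /=; lia.
move=> i t iuv t0 /fintype.subsetP tuv it.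
have [e|e] : t \subset [set u]%SET \/ t \subset [set v]%SET.
- move: iuv; rewrite in_set2 => /orP[] /eqP ei; [right|left];
  apply/fintype.subsetP => j jt; rewrite inE; have := tuv _ jt; rewrite in_set2;
  by case/orP => // /eqP ej; move: it; rewrite ei -ej jt.
- exact: (subcomplexW (full_complex_subcomplex _) uY).
- exact: (subcomplexW (full_complex_subcomplex _) vY).
Qed.

Lemma triangle_in u v x : [set u; v]%SET \in Y -> [set v; x]%SET \in Y ->
  [set u; x]%SET \in Y -> [set u; v; x]%SET \in w -> [set u; v; x]%SET \in Y.
Proof.
move=> uvY vxY uxY uvxw; apply: full_complex_face => //.
- by apply/set0Pn; exists u; rewrite !inE eqxx.
- exact: leq_trans (card_set3_le _ _ _) _.
move=> i t iuvx t0 /fintype.subsetP tuvx it.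
have H s : s \in Y -> (forall j, j \in t -> j \in s) -> t \in Y.
  move=> sY ts; apply: (subcomplexW (full_complex_subcomplex _) sY) => //.
  exact/fintype.subsetP.
have sub j : j \in t -> [/\ j != i & [|| j == u, j == v | j == x]].
  move=> jt; have := tuvx _ jt; rewrite !inE orbA => ->; split => //.
  by apply: contraNneq it => <-.
have : [|| i == u, i == v | i == x] by move: iuvx; rewrite !inE -orbA.
case/or3P => /eqP ei; subst i.
- by apply: (H _ vxY) => j /sub[/negbTE ->]; rewrite !inE.
- by apply: (H _ uxY) => j /sub[/negbTE ->]; rewrite !inE.
- by apply: (H _ uvY) => j /sub[/negbTE ->]; rewrite !inE orbF.
Qed.

Lemma cone_apex u v x : exists z, forall t, t \subset [set u; v; x]%SET ->
  (#|t| < 3)%N -> (z |: t)%SET \in w.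
Proof.
have [|T uvxT T3] := @card_superset_exists _ [set u; v; x]%SET 3.
  by rewrite card_ord n3 card_set3_le.
have /forallP/(_ T) := Hcone; rewrite T3 /= => /existsP[z /andP[_ /forallP H]].
exists z => t tuvx t3; have := H t; rewrite t3 andbT => /implyP; apply.
exact: fintype.subset_trans uvxT.
Qed.

Lemma cone_apex_vertex z u v x :
  (forall t, t \subset [set u; v; x]%SET -> (#|t| < 3)%N -> (z |: t)%SET \in w) ->
  [set z]%SET \in Y.
Proof.
move=> /(_ finset.set0); rewrite cards0 finset.setU0 finset.sub0set.
by move=> /(_ isT isT)/vertex_in.
Qed.

Lemma cone_apex_edge z u v x y :
  (forall t, t \subset [set u; v; x]%SET -> (#|t| < 3)%N -> (z |: t)%SET \in w) ->
  y \in [set u; v; x]%SET -> [set y]%SET \in Y -> [set z; y]%SET \in Y.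
Proof.
move=> Hz yuvx yY; apply: edge_in => //; first exact: cone_apex_vertex Hz.
by apply: Hz; rewrite ?cards1// finset.sub1set.
Qed.

Lemma cone_apex_triangle z u v x y y' :
  (forall t, t \subset [set u; v; x]%SET -> (#|t| < 3)%N -> (z |: t)%SET \in w) ->
  y \in [set u; v; x]%SET -> y' \in [set u; v; x]%SET ->
  [set y; y']%SET \in Y -> [set z; y; y']%SET \in Y.
Proof.
move=> Hz yuvx y'uvx yY; have Ysub := full_complex_subcomplex w.
apply: triangle_in => //.
- apply: (cone_apex_edge Hz) => //; exact: (edge_vert (Ysub _) yY).
- apply: (cone_apex_edge Hz) => //; exact: (edge_vertr (Ysub _) yY).
- rewrite -finset.setUA; apply: Hz; last by rewrite cards2; case: (_ == _).
  by apply/fintype.subsetP => j; rewrite in_set2 => /orP[] /eqP ->.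
Qed.

Lemma common_edge_sym u x : symmetric (common_edge Y u x).
Proof.
by move=> y z; rewrite /common_edge [[set y; z]%SET]finset.setUC; do !case: (_ \in _).
Qed.

(** By [Hexp] every component of the common neighbourhood has at least [m]
    vertices, and by [Hjoin] two such components cannot be distinct.  When [u]
    and [x] are adjacent or equal, [u] itself belongs to the common
    neighbourhood and is adjacent to all of it. *)
Lemma common_connected u x v v' :
  [set v; u]%SET \in Y -> [set v; x]%SET \in Y ->
  [set v'; u]%SET \in Y -> [set v'; x]%SET \in Y ->
  connect (common_edge Y u x) v v'.
Proof.
have Ysub := @full_complex_subcomplex r n w.
move=> vu vx v'u v'x; pose e := common_edge Y u x.
have [ux|ux] := boolP ([set u; x]%SET \in Y).
  have uu : [set u; u]%SET \in Y by rewrite finset.setUid (edge_vert Ysub ux).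
  apply: (@connect_trans _ _ u); apply: connect1; rewrite /common_edge.
    by rewrite vu vx uu ux.
  by rewrite v'u v'x uu ux finset.setUC v'u.
have cs : connect_sym e by apply: sym_connect_sym; exact: common_edge_sym.
have comp_nbr a b : [set a; u]%SET \in Y -> [set a; x]%SET \in Y ->
    connect e a b -> ([set b; u]%SET \in Y) && ([set b; x]%SET \in Y).
  move=> au ax /connectP[p ep ->]; elim: p a au ax ep => [|c p IH] a au ax /=.
    by rewrite au ax.
  by move=> /andP[/and5P[_ _ cu cx _] ep]; apply: IH.
have big a : [set a; u]%SET \in Y -> [set a; x]%SET \in Y ->
    (m <= #|[set b | connect e a b]%SET|)%N.
  move=> au ax; set C := [set b | _]%SET; rewrite leqNgt; apply/negP => /ltnW Cm.
  have uC : u \notin C.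
    by apply: contra ux; rewrite inE => /(comp_nbr _ _ au ax)/andP[].
  have xC : x \notin C.
    apply: contra ux; rewrite inE => /(comp_nbr _ _ au ax)/andP[].
    by rewrite finset.setUC.
  have C0 : (0 < #|C|)%N by apply/card_gt0P; exists a; rewrite inE connect0.
  have /forallP/(_ u)/forallP/(_ x)/forallP/(_ C) := Hexp.
  rewrite C0 Cm uC xC /= => /existsP[z /and5P[zC zw zuw zxw /existsP[y /andP[yC zyw]]]].
  have [yu yx] : [set y; u]%SET \in Y /\ [set y; x]%SET \in Y.
    by move: yC; rewrite inE => /(comp_nbr _ _ au ax)/andP[].
  have zY := vertex_in zw.
  have zu := edge_in zY (edge_vertr Ysub au) zuw.
  have zx := edge_in zY (edge_vertr Ysub ax) zxw.
  have zy := edge_in zY (edge_vert Ysub yu) zyw.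
  have : z \in C.
    move: yC; rewrite !inE => /connect_trans; apply; apply: connect1.
    by rewrite /e /common_edge yu yx zu zx finset.setUC zy.
  by move: zC; rewrite !inE !negb_or => /and3P[_ _ /negbTE ->].
have [S SC Sm] := card_subset_exists (big v vu vx).
have [T TC Tm] := card_subset_exists (big v' v'u v'x).
have inS y : y \in S -> connect e v y by move=> /(fintype.subsetP SC); rewrite inE.
have inT y : y \in T -> connect e v' y by move=> /(fintype.subsetP TC); rewrite inE.
have [dST|] := boolP [disjoint S & T]; last first.
  case/pred0Pn => y /andP[/= /inS vy /inT]; rewrite cs.
  exact: connect_trans.
have /forallP/(_ S)/forallP/(_ T) := Hjoin; rewrite Sm Tm dST !eqxx /=.
move=> /existsP[y /andP[yS /existsP[z /andP[zT yzw]]]].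
have /andP[yu yx] := comp_nbr _ _ vu vx (inS _ yS).
have /andP[zu zx] := comp_nbr _ _ v'u v'x (inT _ zT).
have yz := edge_in (edge_vert Ysub yu) (edge_vert Ysub zu) yzw.
apply: connect_trans (inS _ yS) _; apply: (@connect_trans _ _ z); last by rewrite cs inT.
by apply: connect1; rewrite /e /common_edge yu yx zu zx yz.
Qed.

Lemma good_simply_connected (R : realType) : simply_connected R (realization R Y).
Proof.
have Ysub := @full_complex_subcomplex r n w.
have i0 : 'I_n by exact: Ordinal n3.
have [b Hb] := cone_apex i0 i0 i0.
apply: (realization_simply_connected Ysub _ _ common_connected (cone_apex_vertex Hb)).
- move=> u v x uY vY xY; have [z Hz] := cone_apex u v x.
  by exists z; split; apply: (cone_apex_edge Hz); rewrite // !inE eqxx ?orbT.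
- move=> u v x uv vx ux; have [z Hz] := cone_apex u v x.
  by exists z; split; apply: (cone_apex_triangle Hz); rewrite // !inE eqxx ?orbT.
Qed.

End Deterministic.
End GoodComplex.

(** * Probabilities of the bad events *)

Section BadEvents.
Local Close Scope classical_set_scope.
Context {R : realType} {n : nat} (a : nat -> R).
Hypothesis a01 : forall k, 0 <= a k <= 1.
Implicit Types (w : {set {set 'I_n}}) (S T s t : {set 'I_n}) (u v x y z : 'I_n).

Definition card_prob s : R := a #|s|.-1.
Local Notation q := card_prob.
Local Notation pr := (pr q).

Lemma card_prob01 s : 0 <= q s <= 1. Proof. exact: a01. Qed.

Lemma leq_bin_expn (k m : nat) : ('C(k, m) <= k ^ m)%N.
Proof.
elim: k m => [|k IH] [|m] //; rewrite binS expnS.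
apply: (leq_trans (leq_add (IH m.+1) (IH m))).
rewrite expnS addnC -mulSn leq_mul//.
by case: m => // m; rewrite leq_exp2r.
Qed.

Lemma sum_card_le (m : nat) (c : R) : 0 <= c ->
  \sum_(S : {set 'I_n} | #|S| == m) c <= n%:R ^+ m * c.
Proof.
move=> c0; rewrite sumr_const -[X in X <= _]mulr_natl; apply: ler_wpM2r => //.
rewrite -natrX ler_nat (leq_trans _ (leq_bin_expn _ _))//.
have := cards_draws [set: 'I_n]%SET m; rewrite cardsT card_ord => <-.
by apply: subset_leq_card; apply/fintype.subsetP => S Sm; rewrite inE finset.subsetT.
Qed.

(** These families are disjoint for different [z], which makes the events that
    depend on them independent. *)
Definition star_over T z : {set {set 'I_n}} := [set s | s :\: T == [set z]]%SET.

Lemma pr_no_vertex T (E : 'I_n -> pred {set {set 'I_n}}) (c : R) : c <= 1 ->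
  (forall z, z \notin T -> depends_on (star_over T z) (E z)) ->
  (forall z, z \notin T -> c <= pr (E z)) ->
  pr (fun w => ~~ [exists z, (z \notin T) && E z w]) <= (1 - c) ^+ (n - #|T|).
Proof.
move=> c1 ED Ec.
have -> : pr (fun w => ~~ [exists z, (z \notin T) && E z w]) =
    pr (fun w => all (fun z => ~~ E z w) (enum (~: T)%SET)).
  apply: eq_pr => w; rewrite negb_exists; apply/forallP/allP => [H z|H z].
    by rewrite mem_enum inE => zT; have := H z; rewrite zT.
  by apply/negP => /andP[zT zw]; have := H z; rewrite mem_enum inE zT zw => /(_ isT).
rewrite (pr_none q (D := star_over T)) ?enum_uniq//; last 2 first.
- by move=> z; rewrite mem_enum inE; exact: ED.
- move=> z z' _ _; apply: contraNT => /pred0Pn[s /andP[/=]].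
  by rewrite !inE => /eqP -> /eqP/setP/(_ z); rewrite !inE eqxx => /esym.
have cT : #|~: T| = (n - #|T|)%N.
  by have := cardsC T; rewrite card_ord; lia.
rewrite -cT big_enum /= -prodr_const; apply: ler_prod => z; rewrite inE => zT.
have := Ec _ zT; have := pr_ge0 card_prob01 (fun w => ~~ E z w).
by rewrite prC; lra.
Qed.

Lemma pr_cone T z : #|T| = 3%N -> z \notin T ->
  pr (fun w => [forall t : {set 'I_n},
    (t \subset T) && (#|t| < 3)%N ==> ((z |: t)%SET \in w)]) =
  a 0 * a 1 ^+ 3 * a 2 ^+ 3.
Proof.
move=> T3 zT; pose P := [set t : {set 'I_n} | (t \subset T) && (#|t| < 3)%N]%SET.
have zt t : t \in P -> z \notin t.
  by rewrite inE => /andP[/fintype.subsetP tT _]; apply: contra zT => /tT.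
rewrite (eq_pr q (F := fun w => [set (z |: t)%SET | t in P]%SET \subset w)); last first.
  move=> w; apply/forallP/fintype.subsetP => [H _ /imsetP[t + ->]|H t].
    by rewrite inE => tP; have := H t; rewrite tP.
  by apply/implyP => tP; apply: H; apply: imset_f; rewrite inE.
rewrite pr_superset big_imset /=; last first.
  move=> t t' /zt tz /zt tz' /setP e; apply/setP => i.
  have := e i; rewrite !inE; case: (eqVneq i z) => [->|//].
  by rewrite (negbTE tz) (negbTE tz').
rewrite (partition_big (fun t : {set 'I_n} => inord #|t| : 'I_3) predT) //=.
have H (k : 'I_3) : \prod_(t in P | inord #|t| == k) q (z |: t)%SET = a k ^+ 'C(3, k).
  have -> : 'C(3, k) = #|[set A : {set 'I_n} | A \subset T & #|A| == k]%SET|.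
    by rewrite cards_draws T3.
  rewrite -prodr_const; apply: eq_big => t.
    rewrite !inE; case: (t \subset T) => //=.
    have [t3|] := ltnP #|t| 3; first by rewrite -val_eqE /= inordK.
    by move=> t3; apply/esym/negbTE/eqP => tk; have := ltn_ord k; rewrite -tk ltnNge t3.
  move=> /andP[tP /eqP <-]; rewrite /q cardsU1 (zt _ tP) inordK//.
  by move: tP; rewrite inE => /andP[].
under eq_bigr do rewrite H.
by rewrite !big_ord_recl big_ord0 /= mulr1 mulrA !expr1.
Qed.

Lemma set2_inj z y y' : y != z -> [set z; y]%SET = [set z; y']%SET -> y = y'.
Proof.
move=> yz /setP/(_ y); rewrite !inE eqxx orbT (negbTE yz) /=.
by move/esym/eqP.
Qed.

Lemma pr_cones : pr (fun w => ~~ cones w) <=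
  n%:R ^+ 3 * (1 - a 0 * a 1 ^+ 3 * a 2 ^+ 3) ^+ (n - 3).
Proof.
set c := _ * _ * _.
have c1 : c <= 1.
  have := a01 0; have := a01 1; have := a01 2 => /andP[? ?] /andP[? ?] /andP[? ?].
  rewrite /c !mulr_ile1 ?exprn_ile1 ?exprn_ge0 ?mulr_ge0 ?exprn_ge0//.
apply: (@le_trans _ _ (\sum_(T : {set 'I_n} | #|T| == 3%N) (1 - c) ^+ (n - 3))); last first.
  by apply: sum_card_le; rewrite exprn_ge0// subr_ge0.
pose E T z w := [forall t : {set 'I_n},
    (t \subset T) && (#|t| < 3)%N ==> ((z |: t)%SET \in w)].
apply: le_trans (_ : _ <= \sum_(T in [pred T : {set 'I_n} | #|T| == 3%N])
   pr (fun w => ~~ [exists z, (z \notin T) && E T z w])) _.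
  apply: le_trans (pr_union card_prob01 _ _).
  apply: (pr_mono card_prob01) => w; rewrite negb_forall => /existsP[T].
  by rewrite negb_imply => TE; apply/existsP; exists T.
apply: ler_sum => T /eqP T3; have -> : (n - 3 = n - #|T|)%N by rewrite T3.
apply: pr_no_vertex => // z zT; last first.
  by rewrite pr_cone.
move=> w; apply: eq_forallb => t.
case: (boolP (t \subset T)) => //= tT; case: (_ < 3)%N => //=.
rewrite !inE (_ : _ :\: T = [set z])%SET ?eqxx ?andbT//.
apply/setP => i; rewrite !inE; have [iT|iT] /= := boolP (i \in T).
  by apply/esym/negbTE; apply: contraNneq zT => <-.
by rewrite (contraNF (fintype.subsetP tT i))// orbF.
Qed.

(** The coins of [z], [z u], [z x] are independent of those of the edges from [z]
    to [S]; when [u = x] the edges [z u] and [z x] coincide, which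
    can only increase the probability. *)
Lemma pr_expands_at_vertex u x S z : z \notin (u |: (x |: S))%SET ->
  u \notin S -> x \notin S ->
  a 0 * a 1 ^+ 2 * (1 - (1 - a 1) ^+ #|S|) <=
  pr (fun w => [&& [set z]%SET \in w, [set z; u]%SET \in w, [set z; x]%SET \in w &
    [exists y in S, [set z; y]%SET \in w]]).
Proof.
rewrite !inE !negb_or => /and3P[zu zx zS] uS xS.
pose B : {set {set 'I_n}} := ([set z] |: [set [set z; u]; [set z; x]])%SET.
pose C : {set {set 'I_n}} := [set [set z; y]%SET | y in S]%SET.
have yz y : y \in S -> y != z by apply: contraTneq => ->.
have card2 y : y != z -> #|[set z; y]%SET| = 2%N by move=> yz'; rewrite cards2 eq_sym yz'.
rewrite (eq_pr q (F := fun w => (B \subset w) && ~~ [disjoint C & w])); last first.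
  move=> w; rewrite /B !finset.subUset !finset.sub1set -!andbA; do 3!congr (_ && _).
  apply/existsP/pred0Pn => [[y /andP[yS yw]]|[s /andP[/imsetP[y yS ->] yw]]].
    by exists [set z; y]%SET; rewrite /= yw andbT; apply: imset_f.
  by exists y; rewrite yS.
have BC : C \subset (~: B)%SET.
  apply/fintype.subsetP => s /imsetP[y yS ->]; rewrite !inE !negb_or; apply/and3P; split.
  - apply/eqP => /(congr1 (fun s : {set 'I_n} => #|s|)).
    by rewrite cards1 card2// yz.
  - by apply: contraNneq uS => /(set2_inj (yz _ yS)) <-.
  - by apply: contraNneq xS => /(set2_inj (yz _ yS)) <-.
rewrite (pr_indep q (D := B)); last 2 first.
- move=> w; apply/idP/idP => [Bw|]; first by rewrite finset.subsetI Bw fintype.subxx.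
  by move=> /fintype.subset_trans; apply; exact: finset.subsetIl.
- apply/depends_onC/(depends_onW BC) => w.
  rewrite -!setI_eq0 [in RHS]finset.setIC -finset.setIA finset.setIid.
  by rewrite finset.setIC.
apply: ler_pM.
- by have /andP[? _] := a01 0; have /andP[? _] := a01 1; rewrite mulr_ge0// exprn_ge0.
- have /andP[? ?] := a01 1; rewrite subr_ge0 exprn_ile1//; lra.
- rewrite pr_superset big_setU1 /=; last first.
    rewrite !inE !negb_or; apply/andP; split;
    apply/eqP => /(congr1 (fun s : {set 'I_n} => #|s|));
    by rewrite cards1 card2// eq_sym.
  rewrite {1}/q cards1; have /andP[a00 _] := a01 0; apply: ler_wpM2l => //.
  have qy y : y != z -> q [set z; y]%SET = a 1 by move=> yz'; rewrite /q card2.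
  have [ux|ux] := eqVneq u x.
    rewrite ux finset.setUid big_set1 qy 1?eq_sym// expr2.
    by have /andP[? ?] := a01 1; rewrite ler_piMr.
  rewrite big_setU1 ?big_set1 ?inE ?qy 1?eq_sym//.
  by apply: contra_neq ux => e; apply/esym/(set2_inj _ e); rewrite eq_sym.
- rewrite prC lerD2l lerN2.
  have := @pr_cylinder R _ q finset.set0 C; rewrite big_set0 mul1r => H.
  rewrite (eq_pr q (F := fun w => (finset.set0 \subset w) && [disjoint C & w])); last first.
    by move=> w; rewrite finset.sub0set.
  rewrite H; last by rewrite finset.disjoints_subset finset.sub0set.
  rewrite big_imset /=; last by move=> y y' /yz yz' _; exact: set2_inj.
  rewrite -prodr_const; apply: ler_prod => y /yz yz'.
  by rewrite /q card2//; have /andP[? ?] := a01 1; lra.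
Qed.

Lemma pr_expands_at u x S : u \notin S -> x \notin S ->
  pr (fun w => ~~ expands_at u x S w) <=
  (1 - a 0 * a 1 ^+ 2 * (1 - (1 - a 1) ^+ #|S|)) ^+ (n - #|S|.+2).
Proof.
move=> uS xS; have /andP[a0_ a0'] := a01 0; have /andP[a1_ a1'] := a01 1.
have s01 : 0 <= 1 - (1 - a 1) ^+ #|S| <= 1.
  by rewrite subr_ge0 exprn_ile1 ?lerBlDr ?lerDl ?exprn_ge0//; lra.
have /andP[s0 s1] := s01.
have c01 : 0 <= a 0 * a 1 ^+ 2 * (1 - (1 - a 1) ^+ #|S|) <= 1.
  by rewrite !mulr_ge0 ?exprn_ge0//= !mulr_ile1 ?mulr_ge0 ?exprn_ge0 ?exprn_ile1.
apply: (@le_trans _ _ ((1 - a 0 * a 1 ^+ 2 * (1 - (1 - a 1) ^+ #|S|)) ^+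
    (n - #|(u |: (x |: S))%SET|))); last first.
  apply: ler_wiXn2l; [lra|lra|]; apply: leq_sub2l.
  by rewrite !cardsU1; exact: (leq_add (leq_b1 _) (leq_add (leq_b1 _) (leqnn _))).
apply: pr_no_vertex => [|z zT|z zT]; [lra| |exact: pr_expands_at_vertex].
have starI y : y \in (u |: (x |: S))%SET -> [set z; y]%SET \in star_over (u |: (x |: S)) z.
  move=> yT; rewrite inE; apply/eqP/setP => i; rewrite !inE.
  have [->|iz] /= := eqVneq i z; first by move: zT; rewrite !inE => ->.
  by apply/negbTE/negP => /andP[iT /eqP iy]; move: iT yT; rewrite iy !inE => /negbTE ->.
have star1 : [set z]%SET \in star_over (u |: (x |: S)) z.
  rewrite inE; apply/eqP/setP => i; rewrite !inE andbC.
  by have [->|] := eqVneq i z => //=; move: zT; rewrite !inE => ->.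
move=> w; rewrite finset.in_setI star1 andbT; congr (_ && _).
have su : [set z; u]%SET \in star_over (u |: (x |: S)) z.
  by apply: starI; rewrite !inE eqxx.
have sx : [set z; x]%SET \in star_over (u |: (x |: S)) z.
  by apply: starI; rewrite !inE eqxx orbT.
rewrite finset.in_setI su// andbT; congr (_ && _).
rewrite finset.in_setI sx// andbT; congr (_ && _).
apply: eq_existsb => y; case: (boolP (y \in S)) => //= yS.
by rewrite finset.in_setI starI ?andbT// !inE yS !orbT.
Qed.

(** The union bound over the at most [n ^ k] sets of each size [k]; the hypothesis
    asks that their number be outweighed by the probability of each. *)
Lemma pr_expands m (d : R) : 0 <= d ->
  (forall k, (0 < k <= m)%N -> n%:R ^+ k *
    (1 - a 0 * a 1 ^+ 2 * (1 - (1 - a 1) ^+ k)) ^+ (n - k.+2) <= d) ->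
  pr (fun w => ~~ expands m w) <= n%:R ^+ 2 * (m.+1%:R * d).
Proof.
move=> d0 Hd; pose f k := (1 - a 0 * a 1 ^+ 2 * (1 - (1 - a 1) ^+ k)) ^+ (n - k.+2).
pose P (p : 'I_n * 'I_n * {set 'I_n}) :=
  [&& (0 < #|p.2|)%N, (#|p.2| <= m)%N, p.1.1 \notin p.2 & p.1.2 \notin p.2].
apply: (@le_trans _ _ (\sum_(p in [pred p | P p]) pr (fun w => ~~ expands_at p.1.1 p.1.2 p.2 w))).
  apply: le_trans (pr_union card_prob01 _ _).
  apply: (pr_mono card_prob01) => w; rewrite negb_forall => /existsP[u].
  rewrite negb_forall => /existsP[x]; rewrite negb_forall => /existsP[S].
  by rewrite negb_imply => H; apply/existsP; exists (u, x, S).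
have f0 k : 0 <= f k.
  have /andP[a0_ a0'] := a01 0; have /andP[a1_ a1'] := a01 1.
  have s0 : 0 <= 1 - (1 - a 1) ^+ k by rewrite subr_ge0 exprn_ile1//; lra.
  have s1 : 1 - (1 - a 1) ^+ k <= 1 by rewrite lerBlDr lerDl exprn_ge0//; lra.
  by rewrite exprn_ge0// subr_ge0 !mulr_ile1 ?mulr_ge0 ?exprn_ge0 ?exprn_ile1.
pose Q S := (0 < #|S| <= m)%N.
apply: (@le_trans _ _ (\sum_(p : 'I_n * 'I_n) \sum_(S | Q S) f #|S|)).
  rewrite [X in _ <= X]pair_big_dep /= [X in X <= _]big_mkcond [X in _ <= X]big_mkcond /=.
  apply: ler_sum => -[[u x] S] _ /=; rewrite inE /P /Q /=.
  case: (0 < #|S|)%N => //=; case: (#|S| <= m)%N => //=.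
  case: ifP => [/andP[uS xS]|_]; [exact: pr_expands_at|exact: f0].
rewrite sumr_const card_prod !card_ord -[X in X <= _]mulr_natl natrM -expr2.
apply: ler_wpM2l; first by rewrite exprn_ge0.
rewrite (partition_big (fun S : {set 'I_n} => inord #|S| : 'I_m.+1) predT)//=.
apply: (@le_trans _ _ (\sum_(k < m.+1) d)); last by rewrite sumr_const card_ord mulr_natl.
apply: ler_sum => k _; have [k0|k0] := posnP k.
  rewrite big1// => S /andP[/andP[S0 Sm]] /eqP Sk.
  by move: S0; rewrite -(@inordK m #|S|) ?Sk ?k0.
apply: (@le_trans _ _ (\sum_(S : {set 'I_n} | #|S| == k) f k)).
  rewrite [X in X <= _]big_mkcond [X in _ <= X]big_mkcond /=; apply: ler_sum => S _.
  case: ifP => [/andP[/andP[S0 Sm]] /eqP Sk|_]; last by case: ifP.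
  by rewrite -Sk inordK// eqxx.
apply: le_trans (sum_card_le _ (f0 k)) _; apply: Hd.
by rewrite k0 -ltnS ltn_ord.
Qed.

Lemma pr_joined_at S T : [disjoint S & T] ->
  pr (fun w => ~~ joined_at S T w) <= (1 - a 1) ^+ (#|S| * #|T|).
Proof.
move=> dST.
pose C : {set {set 'I_n}} := [set [set p.1; p.2]%SET | p in finset.setX S T]%SET.
have pne p : p \in finset.setX S T -> p.1 != p.2.
  rewrite inE => /andP[p1 p2]; apply: contraTneq p2 => <-.
  by rewrite (disjointFr dST p1).
have := @pr_cylinder R _ q finset.set0 C; rewrite big_set0 mul1r => H.
rewrite (eq_pr q (F := fun w => (finset.set0 \subset w) && [disjoint C & w])); last first.
  move=> w; rewrite finset.sub0set /=; apply: (canLR negbK).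
  apply/existsP/pred0Pn => [[y /andP[yS /existsP[z /andP[zT yzw]]]]|].
    exists [set y; z]%SET; rewrite /= yzw andbT; apply/imsetP; exists (y, z) => //.
    by rewrite inE yS zT.
  move=> [s /andP[/imsetP[p pST ->] pw]]; move: pST; rewrite inE => /andP[p1 p2].
  by exists p.1; rewrite p1; apply/existsP; exists p.2; rewrite p2.
rewrite H; last by rewrite finset.disjoints_subset finset.sub0set.
rewrite big_imset /=; last first.
  move=> [y z] [y' z']; rewrite !inE /= => /andP[yS zT] /andP[y'S z'T] e.
  have : y \in [set y'; z']%SET by rewrite -e !inE eqxx.
  have : z \in [set y'; z']%SET by rewrite -e !inE eqxx orbT.
  rewrite !inE => /orP[/eqP zy'|/eqP ->].
    by move: zT; rewrite zy' (disjointFr dST y'S).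
  move=> /orP[/eqP -> //|/eqP yz'].
  by move: z'T; rewrite -yz' (disjointFr dST yS).
rewrite -cardsX -prodr_const; apply: ler_prod => p /pne pne'.
by rewrite /q cards2 pne'; have /andP[? ?] := a01 1; rewrite /=; lra.
Qed.

Lemma pr_joined m : pr (fun w => ~~ joined m w) <=
  n%:R ^+ m * (n%:R ^+ m * (1 - a 1) ^+ (m * m)).
Proof.
pose P (p : {set 'I_n} * {set 'I_n}) :=
  [&& #|p.1| == m, #|p.2| == m & [disjoint p.1 & p.2]].
apply: (@le_trans _ _ (\sum_(p in [pred p | P p]) pr (fun w => ~~ joined_at p.1 p.2 w))).
  apply: le_trans (pr_union card_prob01 _ _).
  apply: (pr_mono card_prob01) => w; rewrite negb_forall => /existsP[S].
  rewrite negb_forall => /existsP[T].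
  by rewrite negb_imply => H; apply/existsP; exists (S, T).
have /andP[a1_ a1'] := a01 1.
have e0 : 0 <= (1 - a 1) ^+ (m * m) by rewrite exprn_ge0//; lra.
apply: (@le_trans _ _ (\sum_(S : {set 'I_n} | #|S| == m)
    \sum_(T : {set 'I_n} | #|T| == m) (1 - a 1) ^+ (m * m))).
  rewrite [X in _ <= X]pair_big_dep /= [X in X <= _]big_mkcond [X in _ <= X]big_mkcond /=.
  apply: ler_sum => -[S T] _ /=; rewrite inE /P /=.
  case: (eqVneq #|S| m) => //= Sm; case: (eqVneq #|T| m) => //= Tm.
  case: ifP => // dST.
  by apply: le_trans (pr_joined_at dST) _; rewrite Sm Tm.
apply: le_trans (_ : _ <= \sum_(S : {set 'I_n} | #|S| == m) (n%:R ^+ m * (1 - a 1) ^+ (m * m))) _.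
  by apply: ler_sum => S _; exact: sum_card_le.
by apply: sum_card_le; rewrite mulr_ge0// exprn_ge0.
Qed.

Lemma pr_good m : 1 - pr (fun w => [&& cones w, expands m w & joined m w]) <=
  pr (fun w => ~~ cones w) + (pr (fun w => ~~ expands m w) + pr (fun w => ~~ joined m w)).
Proof.
rewrite -prC.
rewrite !prE -!big_split; apply: ler_sum => w _ /=; rewrite -!mulrDr.
apply: ler_wpM2l; first exact: (wt_ge0 card_prob01).
rewrite -!natrD ler_nat.
by case: (cones w); case: (expands m w); case: (joined m w).
Qed.

End BadEvents.

(** * Numerical estimates *)

Section Estimates.
Local Close Scope classical_set_scope.
Context {R : realType}.

Lemma exprB1_le (x : R) (k : nat) : 0 <= x <= 1 -> (1 - x) ^+ k <= expR (- (x * k%:R)).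
Proof.
move=> /andP[x0 x1]; rewrite -mulNr expRM_natr.
have x1' : 0 <= 1 - x by rewrite subr_ge0.
by apply: lerXn2r; rewrite ?nnegrE ?expR_ge0// (le_trans _ (expR_ge1Dx _)).
Qed.

Lemma expR_le_of_geq (x y : R) (k : nat) : 0 <= x <= 1 -> y <= x * k%:R ->
  (1 - x) ^+ k <= expR (- y).
Proof.
by move=> x01 yx; rewrite (le_trans (exprB1_le _ x01))// ler_expR lerN2.
Qed.

(** From [(1 - x)^k <= exp (- k x) <= 1 / (1 + k x)]: up to a constant factor,
    [1 - (1 - x)^k] is the minimum of [k x] and 1. *)
Lemma one_sub_exprB1_ge (x : R) (k : nat) : 0 <= x <= 1 ->
  x * k%:R <= (1 - (1 - x) ^+ k) * (1 + x * k%:R).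
Proof.
move=> x01; have /andP[x0 x1] := x01.
have t0 : 0 <= x * k%:R by rewrite mulr_ge0.
have e1 : (1 - x) ^+ k * (1 + x * k%:R) <= 1.
  apply: (@le_trans _ _ (expR (- (x * k%:R)) * expR (x * k%:R))).
    apply: ler_pM; rewrite ?expR_ge1Dx ?exprB1_le ?addr_ge0 ?exprn_ge0 ?subr_ge0//.
  by rewrite expRN mulVf// expR_eq0.
by rewrite mulrBl mul1r; lra.
Qed.

(** Here [L] is a small power of [n].  The cutoff [m] is about [L / a 1]: large
    enough for the [n ^ (2 m)] pairs of disjoint [m]-sets to be beaten by
    [(1 - a 1)^(m^2) <= exp (- L m)], and small enough for
    [1 - (1 - a 1)^k] to be at least [k a 1 / (3 L)] when [k <= m], so that
    expansion from a set of size [k] fails with probability at most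
    [exp (- L k / 6)]. *)
Lemma good_bound (n : nat) (a : nat -> R) (L : R) : (forall k, 0 <= a k <= 1) ->
  (12 <= n)%N -> 4 <= L -> L ^+ 2 <= n%:R * (a 0 * a 1 ^+ 3 * a 2 ^+ 3) ->
  n%:R * expR (- (L / 6)) <= 1 ->
  exists m, 1 - pr (card_prob a : {set 'I_n} -> R)
      (fun w => [&& cones w, expands m w & joined m w]) <=
    3 * (n%:R ^+ 4 * expR (- (L / 6))).
Proof.
move=> a01 n12 L4 Lc NE; set N : R := n%:R in Lc NE *; set E := expR _ in NE *.
have N12 : 12 <= N by rewrite /N (ler_nat _ 12).
have E0 : 0 <= E by exact: expR_ge0.
have [/andP[a00 a0l] /andP[a10 a1l] /andP[a20 a2l]] := And3 (a01 0) (a01 1) (a01 2).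
set p := a 1 in Lc a10 a1l *; set c := _ * _ * _ in Lc.
have p3 : 0 <= p ^+ 3 by rewrite exprn_ge0.
have cp3 : c <= a 0 * p ^+ 3.
  by rewrite /c ler_piMr ?mulr_ge0// exprn_ile1.
have cp : c <= p.
  rewrite (le_trans cp3)// (le_trans (ler_piMl p3 a0l))//.
  by rewrite -[X in _ <= X]expr1 ler_wiXn2l.
have c0 : 0 <= c by rewrite /c !mulr_ge0// exprn_ge0.
have c1 : c <= 1 by rewrite (le_trans cp).
have L2N : L ^+ 2 <= N * p by rewrite (le_trans Lc)// ler_wpM2l//; lra.
have p_gt0 : 0 < p.
  rewrite lt0r a10 andbT; apply/eqP => p0; move: L2N; rewrite p0 mulr0 leNgt.
  by rewrite exprn_gt0//; lra.
have Lp0 : 0 <= L / p by rewrite divr_ge0//; lra.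
pose m := (Num.truncn (L / p)).+1.
have /andP[ml mu] := truncn_itv Lp0; rewrite -/m in mu.
have Lm : L <= m%:R * p by rewrite -ler_pdivrMr// ltW.
have mL : m%:R * p <= L + p.
  by rewrite /m -natr1 mulrDl mul1r lerD2r -ler_pdivlMr.
have mN : m%:R + 2 <= N / 2.
  have LpN : L / p <= N / 4 by rewrite ler_pdivrMr//; nra.
  by rewrite /m -natr1; lra.
have NE0 : 0 <= N * E by rewrite mulr_ge0//; lra.
have EX k : expR (- (L / 6 * k%:R)) = E ^+ k by rewrite -mulNr expRM_natr.
have NE4 : N * E <= N ^+ 4 * E.
  by apply: ler_wpM2r => //; apply: ler_eXnr => //; lra.
have NEk k : (0 < k)%N -> N ^+ k * E ^+ k <= N * E.
  by move=> k0; rewrite -exprMn -[X in _ <= X]expr1; apply: ler_wiXn2l.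
exists m.
apply: le_trans (pr_good a01 m) _.
have B1 : pr (card_prob a : {set 'I_n} -> R) (fun w => ~~ cones w) <= N ^+ 4 * E.
  apply: le_trans (pr_cones a01) _; rewrite -/N -/p -/c.
  apply: ler_pM; rewrite ?exprn_ge0 ?subr_ge0//.
    by apply: ler_weXn2l => //; lra.
  apply: expR_le_of_geq; first by rewrite c0 c1.
  have -> : (n - 3)%:R = N - 3 by rewrite natrB// (leq_trans _ n12).
  have : c * (N / 2) <= c * (N - 3) by apply: ler_wpM2l => //; lra.
  have : L <= L ^+ 2 by apply: ler_eXnr => //; lra.
  by lra.
have B2 : pr (card_prob a : {set 'I_n} -> R) (fun w => ~~ expands m w) <= N ^+ 4 * E.
  apply: le_trans (pr_expands a01 (d := N * E) _ _) _; rewrite ?mulr_ge0//; last first.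
    rewrite -/N (_ : N ^+ 4 * E = N ^+ 2 * (N * (N * E))); last by ring.
    apply: ler_wpM2l; first by rewrite exprn_ge0//; lra.
    by apply: ler_wpM2r => //; rewrite -natr1; lra.
  move=> k /andP[k0 km]; rewrite -/N -/p.
  have kmR : (k%:R : R) <= m%:R by rewrite ler_nat.
  have k0R : (0 : R) <= k%:R by [].
  have p01 : 0 <= p <= 1 by rewrite a10.
  have := one_sub_exprB1_ge k p01; set f := 1 - (1 - p) ^+ k => fk.
  have f0 : 0 <= f by rewrite /f subr_ge0 exprn_ile1//; lra.
  have f1 : f <= 1 by rewrite /f lerBlDr lerDl exprn_ge0//; lra.
  have p20 : 0 <= a 0 * p ^+ 2 by rewrite mulr_ge0// exprn_ge0.
  have p21 : a 0 * p ^+ 2 <= 1 by rewrite mulr_ile1// ?exprn_ge0// exprn_ile1.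
  have f3L : p * k%:R <= f * (3 * L).
    apply: (le_trans fk); apply: ler_wpM2l => //.
    by have : p * k%:R <= p * m%:R by [apply: ler_wpM2l]; lra.
  set x := _ * f; have x3L : c * k%:R <= x * (3 * L).
    apply: (@le_trans _ _ (a 0 * p ^+ 3 * k%:R)); first exact: ler_wpM2r.
    have := ler_wpM2l p20 f3L; rewrite /x.
    by rewrite [_ * p ^+ 3]mulrC exprSr; lra.
  have x01 : 0 <= x <= 1 by rewrite mulr_ge0//= mulr_ile1.
  apply: le_trans (NEk k k0); apply: ler_wpM2l; first by rewrite exprn_ge0//; lra.
  rewrite -EX; apply: expR_le_of_geq => //.
  have -> : (n - k.+2)%:R = N - (k%:R + 2).
    rewrite natrB; last by rewrite -(ler_nat R) -addn2 natrD -/N; lra.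
    by rewrite -addn2 natrD.
  have xN : L * k%:R <= x * N * 3.
    have L0 : 0 < L by lra.
    rewrite -(ler_pM2l L0).
    have := ler_wpM2r k0R Lc; have : 0 <= N by lra.
    move=> N0; have := ler_wpM2l N0 x3L; rewrite expr2; lra.
  have /andP[x0 _] := x01.
  have : x * (N / 2) <= x * (N - (k%:R + 2)) by apply: ler_wpM2l => //; lra.
  by lra.
have B3 : pr (card_prob a : {set 'I_n} -> R) (fun w => ~~ joined m w) <= N ^+ 4 * E.
  apply: le_trans (pr_joined a01 m) _; rewrite -/N -/p.
  apply: le_trans NE4; apply: le_trans (NEk (m + m)%N _); last by rewrite addnn double_gt0.
  rewrite [N ^+ (m + m)]exprD -mulrA.
  do 2![apply: ler_wpM2l; first by rewrite exprn_ge0//; lra].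
  rewrite -EX; apply: expR_le_of_geq; first by rewrite a10.
  have m0 : (0 : R) <= m%:R by [].
  have L0 : 0 <= L by lra.
  by have := ler_wpM2r m0 Lm; have := mulr_ge0 L0 m0; rewrite natrD natrM; lra.
by lra.
Qed.
End Estimates.

(** * The limit *)

Lemma psi_ge (R : realType) (r k : nat) (a : 'rV[R]_r.+1) : (3 <= k <= r)%N ->
  (forall i, 0 <= a ord0 i) ->
  a ord0 (inord 0) + 3 * a ord0 (inord 1) + 3 * a ord0 (inord 2) <= psi k a.
Proof.
move=> /andP[k3 kr] a0; have r3 := leq_trans k3 kr.
have iE (j : nat) : (j < 3)%N -> (inord j : 'I_r.+1) = j :> nat.
  by move=> j3; rewrite inordK//; lia.
have ne (i j : nat) : (i < 3)%N -> (j < 3)%N -> i != j ->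
    (inord i : 'I_r.+1) != inord j.
  by move=> i3 j3 ij; rewrite -val_eqE /= !iE.
rewrite /psi (bigD1 (inord 0))//= (bigD1 (inord 1)) ?ne//=.
rewrite (bigD1 (inord 2)) ?ne//= !iE// bin0 mul1r -addrA lerD2l.
have b1 : (3 : R) <= 'C(k, 1)%:R by rewrite (ler_nat _ 3) bin1.
have b2 : (3 : R) <= 'C(k, 2)%:R by rewrite (ler_nat _ 3) (leq_bin2l 2 k3).
have s0 : 0 <= \sum_(i < r.+1 | [&& (i != inord 0) && (i != inord 1) & i != inord 2])
    'C(k, i)%:R * a ord0 i.
  by apply: sumr_ge0 => i _; rewrite mulr_ge0.
have := ler_wpM2r (a0 (inord 1)) b1; have := ler_wpM2r (a0 (inord 2)) b2.
by lra.
Qed.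

Lemma Prob_le1 (R : realType) (r n : nat) (p : 'I_r.+1 -> R)
    (E : {set {set 'I_n}} -> Prop) : (forall i, 0 <= p i <= 1) -> Prob p E <= 1.
Proof.
move=> p01; rewrite Prob_pr -(sum_wt (face_prob (n := n) p)) -[X in _ <= X]/(pr _ predT).
by apply: (pr_mono (face_prob01 p01)).
Qed.

Lemma Prob_ge_good (R : realType) (r n m : nat) (p : 'I_r.+1 -> R) :
  (forall i, 0 <= p i <= 1) -> (2 <= r)%N -> (3 <= n)%N ->
  pr (card_prob (fun k => p (inord k)) : {set 'I_n} -> R)
    (fun w => [&& cones w, expands m w & joined m w]) <=
  Prob p (fun Y : {set {set 'I_n}} => simply_connected R (realization R Y)).
Proof.
move=> p01 r2 n3; rewrite Prob_pr.
apply: (pr_mono (face_prob01 p01)) => w /and3P[wc we wj].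
by apply/asboolP; exact: good_simply_connected r2 n3 wc we wj R.
Qed.

Theorem theorem19 (R : realType) (r k : nat) (hk : (3 <= k <= r)%N)
    (alpha : nat -> 'rV[R]_r.+1) (alpha_star : 'rV[R]_r.+1)
    (alpha_ge0 : forall n i, 0 <= alpha n ord0 i)
    (alpha_cvg : alpha n @[n --> \oo] --> alpha_star)
    (alpha_starD : frakD k alpha_star) :
  Prob (fun i : 'I_r.+1 => n%:R `^ (- alpha n ord0 i))
       (fun Y : {set {set 'I_n}} => simply_connected R (realization R Y))
    @[n --> \oo] --> (1 : R).
Proof.
have [as0 as1 _] := alpha_starD.
pose beta (a : 'rV[R]_r.+1) := a ord0 (inord 0) + 3 * a ord0 (inord 1) + 3 * a ord0 (inord 2).
have beta_lt1 : beta alpha_star < 1 by exact: le_lt_trans (psi_ge hk as0) as1.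
(* half of the margin [4 h] absorbs the convergence of [alpha n]; the other half
   gives [n c >= L ^ 2] with [L = n ^ h] *)
pose h := (1 - beta alpha_star) / 4.
have h0 : 0 < h by rewrite divr_gt0// subr_gt0.
have beta_cvg : beta (alpha n) @[n --> \oo] --> beta alpha_star.
  have coord i : alpha n ord0 i @[n --> \oo] --> alpha_star ord0 i.
    exact: (cvg_comp _ _ alpha_cvg (@coord_continuous R 1 r.+1 ord0 i alpha_star)).
  by apply: cvgD; [apply: cvgD => //|]; apply: cvgM => //; exact: cvg_cst.
have beta_near : \forall n \near \oo, beta (alpha n) <= 1 - 2 * h.
  by apply: cvgr_le beta_cvg _ _; rewrite /h; lra.
(* [exp (L / 6)] dominates [n ^ 5] through its Taylor term of degree [K] *)
pose K := (Num.truncn (5 / h)).+1.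
have hK : 5 <= h * K%:R.
  by rewrite mulrC -ler_pdivrMr// ltW// truncnS_gt.
pose C : R := 6 ^+ K * K`!%:R.
have C0 : 0 < C by rewrite mulr_gt0 ?exprn_gt0// ltr0n fact_gt0.
apply/cvgrPdist_le => e e0.
near=> n.
have n12 : (12 <= n)%N by near: n; exact: nbhs_infty_ge.
have n4K : 4 ^+ K <= (n%:R : R) by near: n; exact: nbhs_infty_ger.
have nC : C <= n%:R by near: n; exact: nbhs_infty_ger.
have nCe : 3 * C / e <= n%:R by near: n; exact: nbhs_infty_ger.
have nb : beta (alpha n) <= 1 - 2 * h by near: n.
pose N : R := n%:R.
rewrite -/N in n4K nC nCe.
have N12 : 12 <= N by rewrite /N (ler_nat _ 12).
have N0 : 0 < N by lra.
have N1 : 1 <= N by lra.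
pose p (i : 'I_r.+1) := N `^ (- alpha n ord0 i).
have p01 i : 0 <= p i <= 1.
  rewrite powR_ge0 /=; have := ler_powR N1 (_ : - alpha n ord0 i <= 0).
  by rewrite powRr0; apply; rewrite oppr_le0.
pose L := N `^ h.
have LK : N ^+ 5 <= L ^+ K.
  by rewrite -!powR_mulrn ?powR_ge0 ?(ltW N0)// /L -powRrM; apply: ler_powR.
have L0 : 0 <= L by exact: powR_ge0.
have L4 : 4 <= L.
  have : (4 : R) ^+ K <= N ^+ 5.
    by apply: (le_trans n4K); apply: ler_eXnr.
  move=> /le_trans/(_ LK); rewrite ler_pXn2r// ?nnegrE//.
have L2 : L ^+ 2 <= N * (p (inord 0) * p (inord 1) ^+ 3 * p (inord 2) ^+ 3).
  have Nn0 : N != 0 by rewrite gt_eqF.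
  have pw s : N * N `^ s = N `^ (1 + s).
    by rewrite powRD ?Nn0 ?implybT// powRr1// ltW.
  rewrite -!powR_mulrn ?powR_ge0// /p -!powRrM -!powRD ?Nn0 ?implybT// pw.
  apply: ler_powR => //.
  move: nb; rewrite /beta.
  move: (alpha n ord0 (inord 0)) (alpha n ord0 (inord 1)) (alpha n ord0 (inord 2)).
  by clear => b0 b1 b2; lra.
have expL : N ^+ 5 / C <= expR (L / 6).
  apply: (@le_trans _ _ ((L / 6) ^+ K / K`!%:R)).
    rewrite /C expr_div_n invfM mulrA.
    by do 2![apply: ler_wpM2r; first by rewrite invr_ge0 ?exprn_ge0].
  have L6 : 0 <= L / 6 by rewrite divr_ge0.
  by apply: le_trans (expR_ge1Dxn K.-1 L6); rewrite lerDr.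
have NE : N ^+ 4 * expR (- (L / 6)) <= C / N.
  rewrite expRN ler_pdivrMr ?expR_gt0// mulrAC ler_pdivlMr//.
  by rewrite -exprSr mulrC -ler_pdivrMr.
have CN : C / N <= 1 /\ 3 * (C / N) <= e.
  split; first by rewrite ler_pdivrMr// mul1r.
  by rewrite mulrA ler_pdivrMr// [e * N]mulrC -ler_pdivrMr.
have NN4 : N <= N ^+ 4 by apply: ler_eXnr.
have NE1 : N * expR (- (L / 6)) <= 1.
  by apply: le_trans (CN.1); apply: le_trans NE; apply: ler_wpM2r.
have [m Hm] := @good_bound R n (fun k => p (inord k)) L (fun k => p01 _) n12 L4 L2 NE1.
have P1 := Prob_le1 (fun Y : {set {set 'I_n}} => simply_connected R (realization R Y)) p01.
have r2 : (2 <= r)%N by case/andP: hk => k3 kr; exact: leq_trans (leq_trans _ k3) kr.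
have n3 : (3 <= n)%N by exact: leq_trans n12.
have P2 := Prob_ge_good m p01 r2 n3.
rewrite -/N -/p ger0_norm ?subr_ge0//.
apply: le_trans (CN.2); apply: le_trans (_ : _ <= 3 * (N ^+ 4 * expR (- (L / 6)))) _.
  by apply: le_trans Hm; rewrite lerD2l lerN2.
by apply: ler_wpM2l.
Unshelve. all: by end_near.
Qed.
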